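(* Let $b\ge 1$ be a fixed integer. (1) The problem $\tau_{R\mathbb{Z}PT}^b$-ESSP can be solved in time polynomial in the size of the input TS $A$. (2) For every $\tau\in\{\tau_{\mathbb{Z}PT}^b,\tau_{\mathbb{Z}PPT}^b,\tau_{R\mathbb{Z}PT}^b\}$, the problem $\tau$-SSP can be solved in time polynomial in the size of the input TS $A$.
   Context: A transition system (TS) is $A=(S,E,\delta,\iota)$ with finite sets $S$ of states and $E$ of events, a partial function $\delta:S\times E\to S$ and an initial state $\iota$ from which every state is reachable; $\delta(s,e)=s'$ is written $s\xrightarrow{e}s'$, and $e$ occurs at $s$ if $\delta(s,e)$ is defined. A type of nets is a TS $\tau=(S_\tau,E_\tau,\delta_\tau)$ without initial state with $S_\tau\subseteq\mathbb{N}$. $\tau_{\mathbb{Z}PT}^b$ has $S_\tau=\{0,\dots,b\}$, $E_\tau=(\{0,\dots,b\}^2\setminus\{(0,0)\})\cup\{0,\dots,b\}$ (integers distinct from pairs), $\delta_\tau(s,(m,n))=s-m+n$ if $s\ge m$ and $s-m+n\le b$ (undefined otherwise), and $\delta_\tau(s,x)=(s+x)\bmod(b+1)$ for $x\in\{0,\dots,b\}$. $\tau_{\mathbb{Z}PPT}^b$ is $\tau_{\mathbb{Z}PT}^b$ with events $(m,n)$, $1\le m,n\le b$, removed. $\tau_{R\mathbb{Z}PT}^b$ has the same states and events as $\tau_{\mathbb{Z}PT}^b$, with $\delta_\tau(s,(m,n))=n$ if $s=m$ and undefined if $s\ne m$, and $\delta_\tau(s,x)=(s+x)\bmod(b+1)$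 for $x\in\{0,\dots,b\}$. A $\tau$-region of $A$ is $(sup,sig)$ with $sup:S\to S_\tau$, $sig:E\to E_\tau$ such that every edge $s\xrightarrow{e}s'$ satisfies $\delta_\tau(sup(s),sig(e))=sup(s')$. An SSA is a pair of distinct states $(s,s')$, solved if $sup(s)\ne sup(s')$; an ESSA is $(e,s)$ with $e$ not occurring at $s$, solved if $\delta_\tau(sup(s),sig(e))$ is undefined. $A$ has the $\tau$-SSP (resp. $\tau$-ESSP) if every SSA (resp. ESSA) is solved by some $\tau$-region. The problem $\tau$-SSP (resp. $\tau$-ESSP) asks whether an input TS has the $\tau$-SSP (resp. $\tau$-ESSP). *)

(* Defs.v *)
From HB Require Import structures.
From mathcomp Require Import all_boot all_order all_algebra.
Set Implicit Arguments.
Unset Strict Implicit.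
Unset Printing Implicit Defensive.

Record TS := MkTS {
  st : finType;
  ev : finType;
  delta : st -> ev -> option st;
  init : st;
  ts_reachable :
    forall s, connect [rel x y | [exists e, delta x e == Some y]] init s }.

Definition edges (A : TS) : seq (st A * ev A * st A) :=
  enum [pred t : st A * ev A * st A | delta t.1.1 t.1.2 == Some t.2].

Record net_type := NetType {
  nst : finType;
  nev : finType;
  ndelta : nst -> nev -> option nst }.

Definition restrict_events (tau : net_type) (keep : pred (nev tau)) : net_type :=
  @NetType (nst tau) {x | keep x} (fun s x => ndelta s (val x)).

(* Pairs (left summand) are kept apart from integers (right summand). *)
Definition pt_event (b : nat) : finType :=
  ({p : 'I_b.+1 * 'I_b.+1 | p != (ord0, ord0)} + 'I_b.+1)%type.

(* [insub k : option 'I_b.+1] is defined exactly when k <= b, and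
   [inZp k : 'I_b.+1] is k %% b.+1. *)
Definition tauZPT (b : nat) : net_type :=
  @NetType 'I_b.+1 (pt_event b) (fun s x =>
    match x with
    | inl p => let: (m, n) := val p in
               if m <= s then insub (s - m + n) else None
    | inr k => Some (inZp (s + k))
    end).

Definition tauZPPT (b : nat) : net_type :=
  restrict_events (tau := tauZPT b) (fun x : pt_event b =>
    match x with
    | inl p => ~~ ((0 < (val p).1) && (0 < (val p).2))
    | inr _ => true
    end).

Definition tauRZPT (b : nat) : net_type :=
  @NetType 'I_b.+1 (pt_event b) (fun s x =>
    match x with
    | inl p => let: (m, n) := val p in if s == m then Some n else None
    | inr k => Some (inZp (s + k))
    end).

Record region (A : TS) (tau : net_type) := Region {
  sup : st A -> nst tau;
  sig : ev A -> nev tau;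
  regionP : forall s e s', delta s e = Some s' ->
    ndelta (sup s) (sig e) = Some (sup s') }.

Definition SSP (tau : net_type) (A : TS) : Prop :=
  forall s s' : st A, s <> s' -> exists R : region A tau, sup R s <> sup R s'.

Definition ESSP (tau : net_type) (A : TS) : Prop :=
  forall (e : ev A) (s : st A), delta s e = None ->
    exists R : region A tau, ndelta (sup R s) (sig R e) = None.

(* Deterministic multi-tape Turing machines with input alphabet bool.  The tape
   alphabet is [option (bool + work)], with blank [None]; there are [extra].+1
   two-way infinite tapes, and [verdict q] is [None] unless q is an accepting
   ([Some true]) or rejecting ([Some false]) halting state. *)
Inductive move := MoveL | Stay | MoveR.

Record TM := MkTM {
  extra : nat;
  work : finType;
  state : finType;
  start : state;
  verdict : state -> option bool;
  trans : state -> {ffun 'I_extra.+1 -> option (bool + work)} ->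
          state * {ffun 'I_extra.+1 -> option (bool + work) * move} }.

Section Run.
Variable M : TM.

Definition symbol := option (bool + work M).

(* (l, r): the head is on the first cell of r, l is the part to its left, read
   from the head outwards; all further cells are blank. *)
Definition tape := (seq symbol * seq symbol)%type.

Definition tape_read (t : tape) : symbol := head None t.2.

Definition tape_act (t : tape) (a : symbol * move) : tape :=
  let: (l, r) := (t.1, behead t.2) in
  match a.2 with
  | MoveL => (behead l, [:: head None l, a.1 & r])
  | Stay => (l, a.1 :: r)
  | MoveR => (a.1 :: l, r)
  end.

Definition config := (state M * {ffun 'I_(extra M).+1 -> tape})%type.

Definition init_config (w : seq bool) : config :=
  (start M,
   [ffun i => if i == ord0 then ([::], [seq Some (inl x) | x <- w])
              else ([::], [::])]).

(* Halting configurations are fixed points. *)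
Definition step (c : config) : config :=
  if verdict c.1 is Some _ then c else
  let: (q, a) := trans c.1 [ffun i => tape_read (c.2 i)] in
  (q, [ffun i => tape_act (c.2 i) (a i)]).

Definition answers_within (t : nat) (w : seq bool) (ans : bool) : Prop :=
  verdict (iter t step (init_config w)).1 = Some ans.

End Run.

Definition unary (k : nat) : seq bool := rcons (nseq k true) false.

(* The word 1^|S| 0 1^|E| 0 1^iota 0 followed by 1^s 0 1^e 0 1^s' 0 for every
   edge (s, e, s'), states and events being numbered by their rank in the
   enumeration of their type.  As S and E have to be listed, unary and binary
   numbering give polynomially related lengths. *)
Definition encode (A : TS) : seq bool :=
  flatten [seq unary k | k <-
    [:: #|st A|; #|ev A|; nat_of_ord (enum_rank (init A))] ++
    flatten [seq [:: nat_of_ord (enum_rank t.1.1); nat_of_ord (enum_rank t.1.2);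
                     nat_of_ord (enum_rank t.2)] | t <- edges A]].

Definition ts_size (A : TS) : nat := #|st A| + #|ev A| + size (edges A).

(* Time is measured against |S| + |E| + |delta|, not against the length of the
   unary encoding. *)
Definition polytime_decidable (Q : TS -> Prop) : Prop :=
  exists (M : TM) (p : {poly nat}), forall A : TS,
    exists ans : bool, (ans <-> Q A) /\
      answers_within M p.[ts_size A]%R (encode A) ans.

(* Main.v *)
(* Replacing an event (m, n) of a region by the integer n - m mod q, where
   q = b + 1, one sees that states s <> s' can be told apart iff the equations
   x_s + y_e = x_s', one for each edge (s, e, s'), have a solution over Z/qZ with
   different values at s and s'.  By translation this value may be required to
   be zero at s.  Likewise, for the type with equality tests, e can be disabled
   at s iff these equations have a solution that is zero at all sources of e and
   nonzero at s.

   Generators of the solution module are computed by adding the equations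
   phi(x) = 0 one at a time to the free module: a pivot p and a generator g are
   replaced by a unimodular combination with phi(g') = 0, for all generators in
   turn, and finally p is multiplied by a generator of the annihilator of
   phi(p).  Their number stays fixed and coefficients are elements of Z/qZ, so no
   number grows.

   On a machine, generators are the rows of an N x N matrix on a tape, where N is
   the length of the input, and every step of the computation is a finite-state
   pass over a row.  So the program consists of nested loops all running exactly
   N times, and its running time is a polynomial in N without further analysis. *)
Require Import Defs.
From mathcomp Require Import all_boot all_order all_algebra ring zify.
Set Implicit Arguments.
Unset Strict Implicit.
Unset Printing Implicit Defensive.
Import GRing.Theory.

(** * Loop programs on Turing machines *)

(** Z/qZ has zero divisors, so elimination cannot divide. Bezout's identity on integer
    representatives replaces division: it gives a matrix of determinant 1 that clears one value and
    is invertible over Z/qZ, so that no solution is lost. Annihilators in Z/qZ are principal, hence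
    the pivot is replaced by a single multiple of itself.

    For the SSP the three types are interchangeable, as all of them contain the integers, which are
    defined everywhere.

    Since q is fixed, ring elements and the combining matrices are handled by the finite control.
    Indices are unbounded and are therefore kept as marks on tracks of a tape. There is a round for
    every z < N, also when z names no state or event; such rounds must not reject, which a constant
    solution ensures.

    Heads lengthen their tapes by blanks, so assertions about tapes leave open what lies beyond the
    known cells. *)

Section Tapes.
Variable W : finType.

(* The tape operations of [Defs], whose types there depend on a whole machine. *)
Definition cell := option (bool + W).
Definition ztape := (seq cell * seq cell)%type.

Definition tread (t : ztape) : cell := head None t.2.

Definition tact (t : ztape) (a : cell * move) : ztape :=
  let: (l, r) := (t.1, behead t.2) in
  match a.2 with
  | MoveL => (behead l, [:: head None l, a.1 & r])
  | Stay => (l, a.1 :: r)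
  | MoveR => (a.1 :: l, r)
  end.

(* Not the identity: it appends a blank to the tape if nothing is right of the
   head. *)
Definition tkeep (t : ztape) : ztape := tact t (tread t, Stay).

Lemma tkeep_id t : t.2 != [::] -> tkeep t = t.
Proof. by case: t => l [|x r]. Qed.

End Tapes.

Section Programs.
Variables (C W : finType) (K : nat).

Local Notation cell := (cell W).
Local Notation ztape := (ztape W).

Definition triple (T : Type) := (T * T * T)%type.

Definition sel (T : Type) (x : triple T) (i : 'I_3) : T :=
  match val i with 0 => x.1.1 | 1 => x.1.2 | _ => x.2 end.

(* There are three data tapes, on which [Do] makes one transition, and [K] clock
   tapes holding the length N of the input in unary; [Loop j c] runs [c] exactly
   N times by means of clock [j]. *)
Inductive cmd :=
| Do of C -> triple cell -> C * triple (cell * move)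
| Seq of cmd & cmd
| If of pred C & cmd
| Loop of 'I_K & cmd.

(* The body of a loop only uses smaller clocks. *)
Fixpoint wf (n : nat) (c : cmd) : bool :=
  match c with
  | Do _ => true
  | Seq c1 c2 => wf n c1 && wf n c2
  | If _ c1 => wf n c1
  | Loop j c1 => (j < n) && wf j c1
  end.

Definition pconf := (C * triple ztape)%type.

Definition tmap T U (f : T -> U) (x : triple T) : triple U := (f x.1.1, f x.1.2, f x.2).

Definition keep (x : pconf) : pconf := (x.1, tmap (@tkeep W) x.2).

Definition act3 (t : triple ztape) (a : triple (cell * move)) : triple ztape :=
  (tact t.1.1 a.1.1, tact t.1.2 a.1.2, tact t.2 a.2).

Section Semantics.
Variable N : nat.

(** [keep] stands for transitions that the compiled machine spends on control alone: they write the
    scanned cells back, which may lengthen a tape. Several of them in a row act like one. *)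
Fixpoint sem (c : cmd) (x : pconf) : pconf :=
  match c with
  | Do f => let: (c', a) := f x.1 (tmap (@tread W) x.2) in (c', act3 x.2 a)
  | Seq c1 c2 => sem c2 (sem c1 x)
  | If p c1 => if p x.1 then sem c1 (keep x) else keep x
  | Loop _ c1 => keep (iter N (fun y => sem c1 (keep y)) x)
  end.

(** The [N + 2] of a loop pays for the failing test, the way back over [N] marks and the step off
    the left blank. *)
Fixpoint cost (c : cmd) : nat :=
  match c with
  | Do _ => 1
  | Seq c1 c2 => cost c1 + cost c2
  | If _ c1 => (cost c1).+1
  | Loop _ c1 => N * (cost c1).+1 + N + 2
  end.

End Semantics.

Lemma cost_poly c : exists p : {poly nat}, forall n, p.[n]%R = cost n c.
Proof.
elim: c => [f|c1 [p1 IH1] c2 [p2 IH2]|p c1 [p1 IH1]|j c1 [p1 IH1]].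
- by exists 1%R => n; rewrite hornerE.
- by exists (p1 + p2)%R => n; rewrite hornerE IH1 IH2.
- by exists (p1 + 1)%R => n; rewrite !hornerE IH1 /= -addn1.
- exists ('X * (p1 + 1) + 'X + 2%:R%:P)%R => n.
  by rewrite !hornerE IH1 /= -[(cost n c1).+1]addn1 -[2]/(1 + 1) addnA.
Qed.

(** * Machine fragments and compilation *)

Notation tapes := {ffun 'I_(3 + K) -> ztape}.

(** [None] as next state is the only exit, so that fragments can be wired together. *)
Record piece := Piece {
  pQ : finType;
  pstart : pQ;
  ptr : pQ -> C -> {ffun 'I_(3 + K) -> cell} ->
        option pQ * C * {ffun 'I_(3 + K) -> cell * move} }.

Definition pstep (P : piece) (x : option (pQ P) * C * tapes) :
    option (pQ P) * C * tapes :=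
  if x.1.1 is Some q then
    let y := ptr q x.1.2 [ffun i => tread (x.2 i)] in
    (y.1, [ffun i => tact (x.2 i) (y.2 i)])
  else x.

Definition within (P : piece) n (x y : option (pQ P) * C * tapes) : Prop :=
  exists2 k, k <= n & iter k (@pstep P) x = y.

Lemma within_refl P n x : @within P n x x.
Proof. by exists 0. Qed.

Lemma within_trans P m n x y z :
  @within P m x y -> within n y z -> within (m + n) x z.
Proof.
by move=> [i im <-] [j jn <-]; exists (j + i); rewrite ?iterD // addnC leq_add.
Qed.

Lemma within_leq P m n x y : m <= n -> @within P m x y -> within n x y.
Proof. by move=> mn [i im <-]; exists i => //; apply: leq_trans mn. Qed.

Lemma within_step P q c T y :
  pstep (Some q, c, T) = y -> @within P 1 (Some q, c, T) y.
Proof. by exists 1. Qed.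

(** [out] is where the enclosing fragment continues when the inner one exits. The simulation is step
    for step, so time bounds carry over unchanged. *)
Definition embeds (P1 P : piece) (inj : pQ P1 -> pQ P) (out : option (pQ P)) :=
  forall q c r, ptr (inj q) c r =
    let y := ptr q c r in
    (if y.1.1 is Some q' then Some (inj q') else out, y.1.2, y.2).

Lemma within_embed P1 P (inj : pQ P1 -> pQ P) out n q c T c' T' :
  embeds inj out ->
  within n (Some q, c, T) (None, c', T') ->
  within n (Some (inj q), c, T) (out, c', T').
Proof.
move=> emb [k]; elim: k n q c T => [//|k IH] [//|n] q c T kn.
rewrite iterSr {2}/pstep /=; set y := ptr q c _.
case Ey: y.1.1 => [q'|].
  rewrite (surjective_pairing y.1) Ey => /IH-/(_ n kn) W1.
  rewrite -add1n; apply: within_trans W1; apply: within_step.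
  by rewrite /pstep /= emb -/y /= Ey.
rewrite (surjective_pairing y.1) Ey => E.
have {E}: (None : option (pQ P1), y.1.2, [ffun i => tact (T i) (y.2 i)])
    = (None, c', T').
  by rewrite -{}E; elim: k {IH kn} => //= k <-.
case=> <- <-; apply: (@within_leq _ 1) => //; apply: within_step.
by rewrite /pstep /= emb -/y /= Ey.
Qed.

Definition mark : cell := Some (inl true).

Definition data (i : 'I_3) : 'I_(3 + K) := lshift K i.
Definition clock (j : 'I_K) : 'I_(3 + K) := rshift 3 j.

Definition stay_but (i : 'I_(3 + K)) (a : cell * move)
    (r : {ffun 'I_(3 + K) -> cell}) : {ffun 'I_(3 + K) -> cell * move} :=
  [ffun k => if k == i then a else (r k, Stay)].

Definition do_piece f : piece :=
  @Piece unit tt (fun _ c r =>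
    let y := f c (r (data ord0), r (data (inord 1)), r (data ord_max)) in
    (None, y.1, [ffun i => match split i with
                           | inl k => sel y.2 k
                           | inr _ => (r i, Stay)
                           end])).

Definition seq_piece (P1 P2 : piece) : piece :=
  @Piece (pQ P1 + pQ P2)%type (inl (pstart P1)) (fun q c r =>
    match q with
    | inl q => let y := ptr q c r in
        (Some (if y.1.1 is Some q' then inl q' else inr (pstart P2)), y.1.2, y.2)
    | inr q => let y := ptr q c r in (omap inr y.1.1, y.1.2, y.2)
    end).

Definition if_piece (p : pred C) (P : piece) : piece :=
  @Piece (option (pQ P)) None (fun q c r =>
    if q is Some q then let y := ptr q c r in (omap Some y.1.1, y.1.2, y.2)
    else (if p c then Some (Some (pstart P)) else None, c,
          [ffun i => (r i, Stay)])).

(* In state [inl true] the loop tests its clock, in state [inl false] it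
   rewinds it. *)
Definition loop_piece (j : 'I_K) (P : piece) : piece :=
  @Piece (bool + pQ P)%type (inl true) (fun q c r =>
    let s := r (clock j) in
    match q with
    | inl true =>
        if s == mark then (Some (inr (pstart P)), c, stay_but (clock j) (s, MoveR) r)
        else (Some (inl false), c, stay_but (clock j) (s, MoveL) r)
    | inl false =>
        if s == mark then (Some (inl false), c, stay_but (clock j) (s, MoveL) r)
        else (None, c, stay_but (clock j) (s, MoveR) r)
    | inr q => let y := ptr q c r in
        (Some (if y.1.1 is Some q' then inr q' else inl true), y.1.2, y.2)
    end).

Fixpoint compile (c : cmd) : piece :=
  match c with
  | Do f => do_piece f
  | Seq c1 c2 => seq_piece (compile c1) (compile c2)
  | If p c1 => if_piece p (compile c1)
  | Loop j c1 => loop_piece j (compile c1)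
  end.

Definition dat (T : tapes) : triple ztape :=
  (T (data ord0), T (data (inord 1)), T (data ord_max)).

(** Both blanks are cells that the setup has visited. The right one keeps the list at the head
    nonempty even for [N = 0], so [tkeep] does not change a clock. *)
Definition at_rest N : ztape := ([:: None], nseq N mark ++ [:: None]).

Lemma clock_data j i : (data i == clock j) = false.
Proof. by rewrite eq_lrshift. Qed.

Lemma split_data i : split (data i) = inl i.
Proof. exact: (unsplitK (inl i)). Qed.

Lemma split_clock j : split (clock j) = inr j.
Proof. exact: (unsplitK (inr j)). Qed.

Lemma dat_stay_but j a (T : tapes) :
  dat [ffun i => tact (T i) (stay_but (clock j) a [ffun k => tread (T k)] i)]
  = tmap (@tkeep W) (dat T).
Proof. by rewrite /dat /tmap /= !ffunE !clock_data. Qed.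

Lemma clock_stay_but j a (T : tapes) k : (T (clock k)).2 != [::] ->
  [ffun i => tact (T i) (stay_but (clock j) a [ffun k => tread (T k)] i)] (clock k)
  = if k == j then tact (T (clock j)) a else T (clock k).
Proof.
move=> Tk; rewrite !ffunE (inj_eq (@rshift_inj _ _)).
by case: eqP => [->//|_]; rewrite -/(tkeep _) tkeep_id.
Qed.

Lemma if_embeds p P : @embeds P (if_piece p P) Some None.
Proof. by []. Qed.
Lemma seq_embeds1 P1 P2 :
  @embeds P1 (seq_piece P1 P2) inl (Some (inr (pstart P2))).
Proof. by move=> q c r /=; case: (ptr q c r) => [[[q'|] ?] ?]. Qed.
Lemma seq_embeds2 P1 P2 : @embeds P2 (seq_piece P1 P2) inr None.
Proof. by []. Qed.
Lemma loop_embeds j P : @embeds P (loop_piece j P) inr (Some (inl true)).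
Proof. by move=> q c r /=; case: (ptr q c r) => [[[q'|] ?] ?]. Qed.

(** Clocks from [n] on may be in the middle of an enclosing loop; for them it is enough that [tkeep]
    does not change them. *)
Definition clocks_ready N n (T : tapes) :=
  (forall j, (T (clock j)).2 != [::]) /\
  (forall j : 'I_K, j < n -> T (clock j) = at_rest N).

(** The head of clock [j] starts on the [k]-th mark, or on the left blank if [k] is 0. *)
Lemma rewind_loop N j P c (T : tapes) k :
  (forall i, (T (clock i)).2 != [::]) -> k <= N ->
  T (clock j) = (behead (nseq k mark ++ [:: None]),
     head None (nseq k mark ++ [:: None]) :: nseq (N - k) mark ++ [:: None]) ->
  exists T', [/\ @within (loop_piece j P) k.+1 (Some (inl false), c, T) (None, c, T'),
    dat T' = tmap (@tkeep W) (dat T), T' (clock j) = at_rest N &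
    forall i, i != j -> T' (clock i) = T (clock i)].
Proof.
elim: k T => [|k IH] T ne kN Tj.
  exists [ffun i => tact (T i) (stay_but (clock j) (None, MoveR) [ffun k => tread (T k)] i)].
  split; last 3 first.
  - by rewrite dat_stay_but.
  - by rewrite clock_stay_but // eqxx Tj /= /tact /= subn0.
  - by move=> i ij; rewrite clock_stay_but // (negbTE ij).
  by apply: within_step; rewrite /pstep /= ffunE Tj.
set T1 := [ffun i => tact (T i) (stay_but (clock j) (mark, MoveL) [ffun k => tread (T k)] i)].
have T1j i : T1 (clock i) = if i == j then tact (T (clock j)) (mark, MoveL) else T (clock i).
  by rewrite clock_stay_but.
have ne1 i : (T1 (clock i)).2 != [::] by rewrite T1j; case: (i == j).
have T1j' : T1 (clock j) = (behead (nseq k mark ++ [:: None]),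
    head None (nseq k mark ++ [:: None]) :: nseq (N - k) mark ++ [:: None]).
  rewrite T1j eqxx Tj /tact /=; congr (_, _ :: _).
  by rewrite -[in RHS](@prednK (N - k)) ?subn_gt0 //= -subnS.
have [T' [W' d' j' i']] := IH T1 ne1 (ltnW kN) T1j'.
exists T'; split => //.
- rewrite -add1n; apply: within_trans W'; apply: within_step.
  by rewrite /pstep /= ffunE Tj.
- by rewrite d' dat_stay_but.
- by move=> i ij; rewrite i' // T1j (negbTE ij).
Qed.

(** That all clocks return to where they were is part of the induction: later commands and later
    runs of a loop body use them again. *)
Theorem compile_correct N n (c : cmd) x (T : tapes) :
  wf n c -> clocks_ready N n T ->
  exists T', [/\ within (cost N c) (Some (pstart (compile c)), x, T)
                                   (None, (sem N c (x, dat T)).1, T'),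
    dat T' = (sem N c (x, dat T)).2 & forall j, T' (clock j) = T (clock j)].
Proof.
elim: c n x T => [f|c1 IH1 c2 IH2|p c1 IH|j c1 IH] n x T /=.
- move=> _ [ne _]; set y := f x _.
  have Ey : f x ([ffun i => tread (T i)] (data ord0), [ffun i => tread (T i)] (data (inord 1)),
    [ffun i => tread (T i)] (data ord_max)) = y by rewrite !ffunE.
  exists (pstep (P := do_piece f) (Some tt, x, T)).2; split.
  + apply: within_step; rewrite {1}/pstep /= Ey.
    by case: (y).
  + rewrite /pstep /= Ey /dat !ffunE !split_data /=.
    by case: (y) => c a; rewrite /act3 /sel /= inordK.
  + move=> j; rewrite /pstep /= !ffunE split_clock -/(tkeep _).
    exact: tkeep_id.
- move=> /andP[w1 w2] r1.
  have [T1 [W1 d1 k1]] := IH1 n x T w1 r1.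
  have r2 : clocks_ready N n T1.
    by case: r1 => ne rest; split=> j; rewrite k1 // => /rest.
  have [T2 [W2 d2 k2]] := IH2 n (sem N c1 (x, dat T)).1 T1 w2 r2.
  have E : ((sem N c1 (x, dat T)).1, dat T1) = sem N c1 (x, dat T).
    by rewrite d1 -surjective_pairing.
  rewrite E in W2 d2; exists T2; split => // [|j]; last by rewrite k2 k1.
  apply: within_trans (within_embed (@seq_embeds1 _ _) W1)
    (within_embed (@seq_embeds2 _ _) W2).
- move=> w1 r1; rewrite /keep /=.
  set T1 := [ffun i => tkeep (T i)].
  have k1 j : T1 (clock j) = T (clock j).
    by case: r1 => ne _; rewrite ffunE tkeep_id.
  have d1 : dat T1 = tmap (@tkeep W) (dat T) by rewrite /dat !ffunE.
  have S1 q : (if p x then Some (Some (pstart (compile c1))) else None) = q ->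
     @within (if_piece p (compile c1)) 1 (Some None, x, T) (q, x, T1).
    move=> <-; apply: within_step; rewrite /pstep /=; congr (_, _).
    by apply/ffunP => i; rewrite !ffunE.
  case: ifP S1 => px S1; last first.
    by exists T1; split => //; apply: within_leq (S1 _ erefl).
  have r2 : clocks_ready N n T1.
    by case: r1 => ne rest; split=> j; rewrite k1 // => /rest.
  have [T2 [W2 d2 k2]] := IH n x T1 w1 r2.
  rewrite d1 in W2 d2; exists T2; split => // [|j]; last by rewrite k2 k1.
  by rewrite -add1n; apply: within_trans (S1 _ erefl) (within_embed (@if_embeds _ _) W2).
- move=> /andP[jn w1] [ne rest].
  pose body (y : pconf) := sem N c1 (keep y).
  have main k : k <= N -> exists T', [/\
     @within (loop_piece j (compile c1)) (k * (cost N c1).+1) (Some (inl true), x, T)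
       (Some (inl true), (iter k body (x, dat T)).1, T'),
     dat T' = (iter k body (x, dat T)).2,
     T' (clock j) = (nseq k mark ++ [:: None], nseq (N - k) mark ++ [:: None]) &
     forall i, i != j -> T' (clock i) = T (clock i)].
    elim: k => [_|k IHk kN].
      exists T; split => //; first exact: within_refl.
      by rewrite rest // subn0.
    have [T1 [W1 d1 j1 i1]] := IHk (ltnW kN).
    have Nk : N - k = (N - k.+1).+1 by rewrite subnS prednK // subn_gt0.
    have ne1 i : (T1 (clock i)).2 != [::].
      by have [->|/i1->//] := eqVneq i j; rewrite j1 Nk.
    set y := iter k body (x, dat T) in W1 d1 *.
    set T2 := [ffun i => tact (T1 i) (stay_but (clock j) (mark, MoveR) [ffun k => tread (T1 k)] i)].
    have T2c i : T2 (clock i) = if i == j then tact (T1 (clock j)) (mark, MoveR) else T1 (clock i).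
      by rewrite clock_stay_but.
    have S2 : @within (loop_piece j (compile c1)) 1 (Some (inl true), y.1, T1)
        (Some (inr (pstart (compile c1))), y.1, T2).
      by apply: within_step; rewrite /pstep /= ffunE j1 Nk.
    (* Clock [j] has left its rest position, so the body may rely only on the clocks below [j], as
       [wf] demands. *)
    have r2 : clocks_ready N j T2.
      split=> i; rewrite T2c.
        case: (i == j) => //; rewrite j1 Nk /tact /=; by case: (N - k.+1).
      move=> ij; have ij' : i != j by rewrite neq_ltn ij.
      by rewrite (negbTE ij') i1 // rest // (ltn_trans ij).
    have [T3 [W3 d3 j3]] := IH j y.1 T2 w1 r2.
    have E : (y.1, dat T2) = keep y by rewrite dat_stay_but d1.
    rewrite E in W3 d3; exists T3; split => //.
    + rewrite mulSn addnC; apply: within_trans W1 _.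
      by rewrite -[X in within X]add1n; apply: within_trans S2 (within_embed (@loop_embeds _ _) W3).
    + by rewrite j3 T2c eqxx j1 Nk.
    + by move=> i ij; rewrite j3 T2c (negbTE ij) i1.
  have [T1 [W1 d1 j1 i1]] := main N (leqnn N).
  have ne1 i : (T1 (clock i)).2 != [::].
    by have [->|/i1->//] := eqVneq i j; rewrite j1; case: (N - N).
  set y := iter N body (x, dat T) in W1 d1 *.
  set T2 := [ffun i => tact (T1 i) (stay_but (clock j) (None, MoveL) [ffun k => tread (T1 k)] i)].
  have T2c i : T2 (clock i) = if i == j then tact (T1 (clock j)) (None, MoveL) else T1 (clock i).
    by rewrite clock_stay_but.
  have S2 : @within (loop_piece j (compile c1)) 1 (Some (inl true), y.1, T1)
      (Some (inl false), y.1, T2).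
    by apply: within_step; rewrite /pstep /= ffunE j1 subnn.
  have ne2 i : (T2 (clock i)).2 != [::] by rewrite T2c; case: (i == j).
  have T2j : T2 (clock j) = (behead (nseq N mark ++ [:: None]),
      head None (nseq N mark ++ [:: None]) :: nseq (N - N) mark ++ [:: None]).
    by rewrite T2c eqxx j1 /tact /= subnn.
  have [T3 [W3 d3 j3 i3]] := rewind_loop (compile c1) y.1 ne2 (leqnn N) T2j.
  exists T3; split.
  + rewrite -addnA; apply: within_trans W1 _.
    by rewrite addn2 -[X in within X]add1n; apply: within_trans S2 W3.
  + by rewrite d3 dat_stay_but d1.
  + move=> i; have [->|ij] := eqVneq i j; first by rewrite j3 rest.
    by rewrite i3 // T2c (negbTE ij) i1.
Qed.

(* The first pass writes a mark on every other tape for each input symbol, the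
   second one rewinds all tapes. *)
Definition setup_piece : piece :=
  @Piece bool true (fun fwd c r =>
    let more := isSome (r (data ord0)) in
    if fwd then
      if more then
        (Some true, c,
         [ffun i => (if i == data ord0 then r i else mark, MoveR)])
      else (Some false, c, [ffun i => (r i, MoveL)])
    else if more then (Some false, c, [ffun i => (r i, MoveL)])
    else (None, c, [ffun i => (r i, MoveR)])).

Definition input_tape (w : seq bool) : ztape :=
  ([:: None], [seq Some (inl x) | x <- w] ++ [:: None]).

Definition inputs (w : seq bool) : triple ztape :=
  (input_tape w, at_rest (size w), at_rest (size w)).

Section Setup.
Variable w : seq bool.

Let content (i : 'I_(3 + K)) : seq cell :=
  if i == data ord0 then [seq Some (inl x) | x <- w] else nseq (size w) mark.

Let size_content i : size (content i) = size w.
Proof. by rewrite /content; case: eqP => _; rewrite ?size_map ?size_nseq. Qed.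

Let content_some i k : k < size w -> isSome (nth None (content i) k).
Proof.
move=> kw; rewrite /content; case: eqP => _; last by rewrite nth_nseq kw.
by rewrite (nth_map false).
Qed.

Let content_other i k : i != data ord0 -> k < size w ->
  nth None (content i) k = mark.
Proof. by move=> i0 kw; rewrite /content (negbTE i0) nth_nseq kw. Qed.

Lemma setup_forward c (T : tapes) k : k <= size w ->
  (forall i, T i = ([::], if i == data ord0 then content i else [::])) ->
  exists T' : tapes,
    @within setup_piece k (Some true, c, T) (Some true, c, T') /\
    forall i, T' i = (rev (take k (content i)),
                      if i == data ord0 then drop k (content i) else [::]).
Proof.
move=> kw T0; elim: k kw => [_|k IH kw].
  exists T; split=> [|i]; first exact: within_refl.
  by rewrite T0 take0 drop0.
have [T1 [W1 E1]] := IH (ltnW kw).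
exists (pstep (P := setup_piece) (Some true, c, T1)).2.
have R0 : [ffun i => tread (T1 i)] (data ord0) = nth None (content (data ord0)) k.
  by rewrite ffunE E1 eqxx /tread /= -nth0 nth_drop addn0.
split.
  rewrite -addn1; apply: within_trans W1 _; apply: within_step.
  by rewrite /pstep /= R0 content_some.
move=> i; rewrite /pstep /= R0 content_some //= !ffunE E1.
rewrite (take_nth None) ?size_content // rev_rcons.
have [->|i0] := eqVneq i (data ord0).
  rewrite /tact /tread /=; congr (_ :: _, _); first by rewrite -nth0 nth_drop addn0.
  by rewrite -[in LHS]drop1 drop_drop add1n.
by rewrite /tact /= content_other.
Qed.

Lemma setup_backward c (T : tapes) k : k <= size w ->
  (forall i, T i = (behead (rev (take k (content i))),
     head None (rev (take k (content i))) :: drop k (content i) ++ [:: None])) ->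
  exists T' : tapes,
    @within setup_piece k.+1 (Some false, c, T) (None, c, T') /\
    forall i, T' i = ([:: None], content i ++ [:: None]).
Proof.
elim: k T => [|k IH] T kw E.
  exists (pstep (P := setup_piece) (Some false, c, T)).2.
  have R0 : [ffun i => tread (T i)] (data ord0) = None.
    by rewrite ffunE E take0.
  split; first by apply: within_step; rewrite /pstep /= R0.
  by move=> i; rewrite /pstep /= R0 /= !ffunE E take0 drop0.
have R i : tread (T i) = nth None (content i) k.
  by rewrite E (take_nth None) ?size_content // rev_rcons.
pose T1 := (pstep (P := setup_piece) (Some false, c, T)).2.
have R0 : [ffun i => tread (T i)] (data ord0) = nth None (content (data ord0)) k.
  by rewrite ffunE R.
have [|T' [W' E']] := IH T1 (ltnW kw).
  move=> i; rewrite /T1 /pstep /= R0 content_some //= !ffunE R E.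
  rewrite (take_nth None) ?size_content // rev_rcons /= /tact /=.
  by rewrite [drop k _](drop_nth None) ?size_content.
exists T'; split=> //; rewrite -add1n; apply: within_trans W'.
apply: within_step.
by rewrite /T1 /pstep /= R0 content_some.
Qed.

Lemma setup_correct c (T : tapes) :
  (forall i, T i = ([::], if i == data ord0 then [seq Some (inl x) | x <- w]
                          else [::])) ->
  exists T' : tapes,
    [/\ @within setup_piece (size w + (size w).+2) (Some true, c, T) (None, c, T'),
     dat T' = inputs w & forall j, T' (clock j) = at_rest (size w)].
Proof.
move=> T0; have {}T0 i : T i = ([::], if i == data ord0 then content i else [::]).
  by rewrite T0 /content; case: eqP.
have [T1 [W1 E1]] := setup_forward c (leqnn _) T0.
have E i : T1 i = (rev (content i), [::]).
  by rewrite E1 -(size_content i) take_size drop_size; case: eqP.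
pose T2 := (pstep (P := setup_piece) (Some true, c, T1)).2.
have R0 : [ffun i => tread (T1 i)] (data ord0) = None by rewrite ffunE E.
have [|T' [W' E']] := @setup_backward c T2 (size w) (leqnn _).
  move=> i; rewrite /T2 /pstep /= R0 /= !ffunE E /tact /tread /=.
  by rewrite -(size_content i) take_size drop_size.
exists T'; split.
- apply: within_trans W1 _; rewrite -[X in within X]add1n; apply: within_trans W'.
  by apply: within_step; rewrite /T2 /pstep /= R0.
- by rewrite /dat !E' /content eqxx !(inj_eq (@lshift_inj _ _)) -!val_eqE /= inordK.
- by move=> j; rewrite E' /content eq_sym clock_data.
Qed.

End Setup.

(** * From fragments to Turing machines *)

Section ToTM.
Variables (P : piece) (c0 : C) (acc : pred C).

Definition tm_of : TM :=
  @MkTM (2 + K) W (option (pQ P) * C)%type (Some (pstart P), c0)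
    (fun q => if q.1 is None then Some (acc q.2) else None)
    (fun q r => if q.1 is Some q1 then ptr q1 q.2 r
                else (q, [ffun i => (r i, Stay)])).

Lemma step_tm_of (x : option (pQ P) * C * tapes) :
  step (x : config tm_of) = pstep x.
Proof.
case: x => [[[q|] c] T] //; rewrite /step /pstep /=.
by case: (ptr q c _) => q' a.
Qed.

Lemma tm_of_answers w c T n :
  within n (Some (pstart P), c0, (init_config tm_of w).2) (None, c, T) ->
  answers_within tm_of n w (acc c).
Proof.
case=> k kn E; rewrite /answers_within.
have it m x : iter m (@step tm_of) x = iter m (@pstep P) x.
  by elim: m => //= m ->; rewrite step_tm_of.
rewrite it -(subnK kn) iterD -[init_config _ _]/(Some (pstart P), c0, _) E.
by elim: (n - k) => //= m IH; rewrite /pstep; case: (iter m _ _) IH => [[[q|] c'] T'].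
Qed.

End ToTM.

(** The verdict depends on the final control state alone, so from here on programs are studied
    through [sem], with the running time already settled. *)
Theorem cmd_decides (c : cmd) (c0 : C) (acc : pred C) : wf K c ->
  exists (M : TM) (p : {poly nat}), forall w : seq bool,
    answers_within M p.[size w]%R w (acc (sem (size w) c (c0, inputs w)).1).
Proof.
move=> wfc; have [p Ep] := cost_poly c.
pose P := seq_piece setup_piece (compile c).
exists (tm_of P c0 acc), ('X + ('X + 2%:R%:P) + p)%R => w.
have -> : ('X + ('X + 2%:R%:P) + p).[size w]%R
    = (size w + (size w).+2 + cost (size w) c).
  by rewrite !hornerE Ep -[(size w).+2]addn2 -[2]/(1 + 1) !addnA.
have [|T1 [W1 d1 k1]] := @setup_correct w c0 (init_config (tm_of P c0 acc) w).2.
  by move=> i; rewrite ffunE -val_eqE; case: i => [[|i] ?].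
have [|T2 [W2 d2 _]] := @compile_correct (size w) K c c0 T1 wfc.
  by split=> j; rewrite k1 //; case: (size w).
rewrite d1 in W2; apply: (tm_of_answers (T := T2)).
exact: within_trans (within_embed (@seq_embeds1 _ _) W1)
         (within_embed (@seq_embeds2 _ _) W2).
Qed.

End Programs.

Arguments Do {C W K} _.

(** * Passes over the tapes *)

(** Describes both a machine pass along a row and a pivot travelling through the list of
    generators. *)
Fixpoint mapacc (X Y Z : Type) (f : X -> Y -> X * Z) (x : X) (s : seq Y) :
    X * seq Z :=
  if s is y :: s' then
    let u := f x y in let v := mapacc f u.1 s' in (v.1, u.2 :: v.2)
  else (x, [::]).

Lemma size_mapacc (X Y Z : Type) (f : X -> Y -> X * Z) x s :
  size (mapacc f x s).2 = size s.
Proof. by elim: s x => //= y s IH x; rewrite IH. Qed.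

Definition tab N T (F : 'I_N -> T) : seq T := [seq F j | j <- enum 'I_N].

Lemma size_tab N T (F : 'I_N -> T) : size (tab F) = N.
Proof. by rewrite size_map size_enum_ord. Qed.

Lemma eq_tab N T (F G : 'I_N -> T) : F =1 G -> tab F = tab G.
Proof. by move=> FG; apply: eq_map. Qed.

Lemma zip_tab N T U (F : 'I_N -> T) (G : 'I_N -> U) :
  zip (tab F) (tab G) = tab (fun j => (F j, G j)).
Proof. exact: zip_map. Qed.

(** [st j] is the control state just before cell [j]; giving it in closed form spares an induction
    for each pass. *)
Lemma mapacc_tab N (X Y Z : Type) (f : X -> Y -> X * Z)
    (st : nat -> X) (F : 'I_N -> Y) (G : 'I_N -> Z) :
  (forall j : 'I_N, f (st j) (F j) = (st j.+1, G j)) ->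
  mapacc f (st 0) (tab F) = (st N, tab G).
Proof.
move=> fE.
suff: forall s : seq 'I_N, forall i, map val s = iota i (size s) ->
  mapacc f (st i) (map F s) = (st (i + size s), map G s).
  by move/(_ (enum 'I_N) 0); rewrite val_enum_ord size_enum_ord; apply.
elim=> [|j s IH] i /=; first by rewrite addn0.
by case=> ji /IH IHs; rewrite -ji fE /= ji IHs addSnnS.
Qed.

Section Passes.
Variables (C Vc Gc : finType) (v0 : Vc) (g0 : Gc) (N : nat).

Notation W := (Vc + Gc)%type.
Notation cell := (cell W).
Notation ztape := (ztape W).
Notation cmd := (cmd C W 4).
Notation pconf := (pconf C W).

Definition encV (v : Vc) : cell := Some (inr (inl v)).
Definition encG (g : Gc) : cell := Some (inr (inr g)).
(** The default lets the first [reset] run over the marks that the setup left on this tape. *)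
Definition decV (x : cell) : Vc := if x is Some (inr (inl v)) then v else v0.
Definition decG (x : cell) : Gc := if x is Some (inr (inr g)) then g else g0.

(* The tape [t] has its head between [z.1] and [z.2]; what follows [z.2] is
   arbitrary. *)
Definition at_tape (t z : ztape) := t.1 = z.1 /\ exists r, t.2 = z.2 ++ r.

(** The arbitrary rest absorbs the blank that [tkeep] may append, so control steps preserve every
    assertion about tapes. *)
Lemma at_keep t z : at_tape t z -> at_tape (tkeep t) z.
Proof.
case: t z => l s [zl [|x zs]] [/= -> [r ->]]; split => //; first by exists (tkeep ([::], r)).2.
by exists r.
Qed.

Lemma at_left t x l s :
  at_tape t (x :: l, s) -> at_tape (tact t (tread t, MoveL)) (l, x :: s).
Proof.
case: t => lt st [/= -> [r ->]]; split => //=.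
by case: s => [|y s]; [exists (tkeep ([::], r)).2 | exists r].
Qed.

Lemma at_read t l x s : at_tape t (l, x :: s) -> tread t = x.
Proof. by case: t => lt st [/= _ [r ->]]. Qed.

Lemma at_right t l s y :
  at_tape t (l, s) -> at_tape (tact t (y, MoveR)) (y :: l, behead s).
Proof.
case: t => lt st [/= -> [r ->]]; split => //=.
by case: s => [|x s]; [exists (behead r) | exists r].
Qed.

Lemma at_weaken t l s1 s2 : at_tape t (l, s1 ++ s2) -> at_tape t (l, s1).
Proof. by case=> /= El [r Er]; split=> //; exists (s2 ++ r); rewrite catA. Qed.

Definition rep (x a : pconf) :=
  [/\ x.1 = a.1, at_tape x.2.1.1 a.2.1.1, at_tape x.2.1.2 a.2.1.2 &
      at_tape x.2.2 a.2.2].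

Lemma rep_keep x a : rep x a -> rep (keep x) a.
Proof. by case=> ? ? ? ?; split=> //; apply: at_keep. Qed.

(** A Hoare triple whose assertions are single abstract configurations. *)
Definition spec (P : cmd) (a b : pconf) :=
  forall x, rep x a -> rep (sem N P x) b.

Definition spec_iter n (P : cmd) (a b : pconf) :=
  forall x, rep x a -> rep (iter n (fun y => sem N P (keep y)) x) b.

Lemma spec_seq P Q b a c : spec P a b -> spec Q b c -> spec (Seq P Q) a c.
Proof. by move=> sP sQ x /sP/sQ. Qed.

Lemma spec_if (p : pred C) P a b :
  (if p a.1 then spec P a b else a = b) -> spec (If p P) a b.
Proof.
move=> sP x ra /=; have [-> _ _ _] := ra.
by case: ifP sP => [_ sP|_ <-]; [apply: sP|]; apply: rep_keep.
Qed.

Lemma spec_iter0 P a : spec_iter 0 P a a.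
Proof. by move=> x. Qed.

Lemma spec_iterS n P a b c :
  spec P a b -> spec_iter n P b c -> spec_iter n.+1 P a c.
Proof. by move=> sP sn x /rep_keep/sP/sn; rewrite iterSr. Qed.

Lemma spec_loop j P a b : spec_iter N P a b -> spec (Loop j P) a b.
Proof. by move=> sN x /sN/rep_keep. Qed.

Lemma spec_iterD m n P b a c :
  spec_iter m P a b -> spec_iter n P b c -> spec_iter (m + n) P a c.
Proof. by move=> sm sn x /sm/sn; rewrite addnC iterD. Qed.

Lemma spec_iter_nat n P (a : nat -> pconf) :
  (forall i, i < n -> spec P (a i) (a i.+1)) -> spec_iter n P (a 0) (a n).
Proof.
elim: n a => [|n IH] a sP; first exact: spec_iter0.
apply: (spec_iterS (sP 0 _)) => //.
by apply: (IH (fun i => a i.+1)) => i ltin; apply: sP.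
Qed.

Definition do_ctrl (f : C -> C) : cmd :=
  Do (fun c r => (f c, tmap (fun s => (s, Stay)) r)).

Lemma spec_ctrl f c d : spec (do_ctrl f) (c, d) (f c, d).
Proof. by move=> x [xc ? ? ?]; split=> /=; rewrite ?xc //; apply: at_keep. Qed.

Lemma spec_ctrl_seq f P c d a :
  spec P (f c, d) a -> spec (Seq (do_ctrl f) P) (c, d) a.
Proof. by apply: spec_seq; apply: spec_ctrl. Qed.

Lemma spec_seq_ctrl f P a c d :
  spec P a (c, d) -> spec (Seq P (do_ctrl f)) a (f c, d).
Proof. by move=> sP; apply: spec_seq sP _; apply: spec_ctrl. Qed.

Definition shift (m : triple move) : cmd :=
  Do (fun c r => (c, ((r.1.1, m.1.1), (r.1.2, m.1.2), (r.2, m.2)))).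

Definition read_input (f : C -> bool -> C) : cmd :=
  Do (fun c r => (f c (r.1.1 == Some (inl true)),
                  ((r.1.1, MoveR), (r.1.2, Stay), (r.2, Stay)))).

Lemma spec_read_input f c l x s zv zg :
  spec (read_input f) (c, ((l, Some (inl x) :: s), zv, zg))
                      (f c x, ((Some (inl x) :: l, s), zv, zg)).
Proof.
move=> [xc [[ti tv] tg]] [/= -> ai av ag].
split=> /=; [|rewrite (at_read ai)| |]; try exact: at_keep.
- by rewrite (at_read ai) /=; case: x {ai}.
- exact: (at_right _ ai).
Qed.

Lemma spec_left_input n c x l s zv zg : size x = n ->
  spec_iter n (shift (MoveL, Stay, Stay)) (c, ((rev x ++ l, s), zv, zg))
                                  (c, ((l, x ++ s), zv, zg)).
Proof.
move=> <-; elim/last_ind: x s => [|x y IH] s; first exact: spec_iter0.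
rewrite size_rcons rev_rcons cat_rcons; apply: spec_iterS (IH _).
move=> [xc [[ti tv] tg]] [/= -> ai av ag].
by split=> //=; [apply: at_left|apply: at_keep|apply: at_keep].
Qed.

Lemma spec_left_V n c zi x l s zg : size x = n ->
  spec_iter n (shift (Stay, MoveL, Stay)) (c, (zi, (rev x ++ l, s), zg))
                                  (c, (zi, (l, x ++ s), zg)).
Proof.
move=> <-; elim/last_ind: x s => [|x y IH] s; first exact: spec_iter0.
rewrite size_rcons rev_rcons cat_rcons; apply: spec_iterS (IH _).
move=> [xc [[ti tv] tg]] [/= -> ai av ag].
by split=> //=; [apply: at_keep|apply: at_left|apply: at_keep].
Qed.

Lemma spec_left_G n c zi zv x l s : size x = n ->
  spec_iter n (shift (Stay, Stay, MoveL)) (c, (zi, zv, (rev x ++ l, s)))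
                                  (c, (zi, zv, (l, x ++ s))).
Proof.
move=> <-; elim/last_ind: x s => [|x y IH] s; first exact: spec_iter0.
rewrite size_rcons rev_rcons cat_rcons; apply: spec_iterS (IH _).
move=> [xc [[ti tv] tg]] [/= -> ai av ag].
by split=> //=; [apply: at_keep|apply: at_keep|apply: at_left].
Qed.

Lemma spec_right_G n c zi zv x l s : size x = n ->
  spec_iter n (shift (Stay, Stay, MoveR)) (c, (zi, zv, (l, x ++ s)))
                                  (c, (zi, zv, (rev x ++ l, s))).
Proof.
move=> <-; elim: x l => [|y x IH] l; first exact: spec_iter0.
rewrite rev_cons cat_rcons; apply: spec_iterS (IH _).
move=> [xc [[ti tv] tg]] [/= -> ai av ag].
split=> //=; try exact: at_keep.
by rewrite (at_read ag); apply: (at_right _ ag).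
Qed.

Definition cell_clock : 'I_4 := @Ordinal 4 0 isT.
Definition row_clock : 'I_4 := @Ordinal 4 1 isT.

Definition scanV (f : C -> Vc -> C * Vc) : cmd :=
  Seq (Loop cell_clock (Do (fun c r =>
         let y := f c (decV r.1.2) in
         (y.1, ((r.1.1, Stay), (encV y.2, MoveR), (r.2, Stay))))))
      (Loop cell_clock (shift (Stay, MoveL, Stay))).

Definition scanVG (f : C -> Vc * Gc -> C * (Vc * Gc)) : cmd :=
  Seq (Loop cell_clock (Do (fun c r =>
         let y := f c (decV r.1.2, decG r.2) in
         (y.1, ((r.1.1, Stay), (encV y.2.1, MoveR), (encG y.2.2, MoveR))))))
 (Seq (Loop cell_clock (shift (Stay, MoveL, Stay)))
      (Loop cell_clock (shift (Stay, Stay, MoveL)))).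

(** The G head stays behind the new row, so repeated use appends rows. *)
Definition fill_row (f : Vc -> Gc) : cmd :=
  Seq (Loop cell_clock (Do (fun c r =>
         (c, ((r.1.1, Stay), (r.1.2, MoveR), (encG (f (decV r.1.2)), MoveR))))))
      (Loop cell_clock (shift (Stay, MoveL, Stay))).

Definition rewind_G : cmd :=
  Loop row_clock (Loop cell_clock (shift (Stay, Stay, MoveL))).

(** [P] is to return the G head to the start of its row; the V tape is aligned with each row in
    turn. *)
Definition for_rows (P : cmd) : cmd :=
  Seq (Loop row_clock
         (Seq P (Loop cell_clock (shift (Stay, Stay, MoveR))))) rewind_G.

Definition tapeV (s : seq cell) : ztape := ([:: None], s ++ [:: None]).

Lemma spec_scanV_raw f c zi v zg : size v = N ->
  let y := mapacc (fun c x => f c (decV x)) c v in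
  spec (scanV f) (c, (zi, tapeV v, zg)) (y.1, (zi, tapeV (map encV y.2), zg)).
Proof.
move=> sv y; rewrite /tapeV /y.
apply: spec_seq; last first.
  by apply: spec_loop; apply: spec_left_V; rewrite size_map size_mapacc.
apply: spec_loop; rewrite -sv; elim: v {1 3}[:: None] c {y sv} => [|x v IH] l c /=.
  exact: spec_iter0.
rewrite rev_cons cat_rcons; apply: spec_iterS (IH _ _).
move=> [xc [[ti tv] tg]] [/= -> ai av ag].
split=> /=; rewrite ?(at_read av) //; try exact: at_keep.
exact: (at_right _ av).
Qed.

Lemma spec_scanV (st : nat -> C) (F : 'I_N -> cell) (F' : 'I_N -> Vc) f zi zg :
  (forall j : 'I_N, f (st j) (decV (F j)) = (st j.+1, F' j)) ->
  spec (scanV f) (st 0, (zi, tapeV (tab F), zg))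
                 (st N, (zi, tapeV (tab (encV \o F')), zg)).
Proof.
move=> fE; have := @spec_scanV_raw f (st 0) zi (tab F) zg (size_tab _).
by rewrite (mapacc_tab (st := st) (G := F')) //= -map_comp.
Qed.

Lemma spec_scanVG_seq f c zi v lg g sg : size v = N -> size g = N ->
  let y := mapacc f c (zip v g) in
  spec (scanVG f)
    (c, (zi, tapeV (map encV v), (lg, map encG g ++ sg)))
    (y.1, (zi, tapeV (map encV (unzip1 y.2)),
              (lg, map encG (unzip2 y.2) ++ sg))).
Proof.
move=> sv sg' y; rewrite /tapeV.
have sy : size y.2 = N by rewrite size_mapacc size_zip sv sg' minnn.
apply: spec_seq; last first.
  apply: spec_seq; last first.
    by apply: spec_loop; apply: spec_left_G; rewrite !size_map.
  by apply: spec_loop; apply: spec_left_V; rewrite !size_map.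
apply: spec_loop; rewrite /y -[X in spec_iter X]sv.
have {sy sv sg' y} : size v = size g by rewrite sv.
elim: v g {1 3}[:: None] lg c => [|x v IH] [|x' g] l lg c //=.
  by move=> _; apply: spec_iter0.
case=> svg; rewrite !rev_cons !cat_rcons; apply: spec_iterS (IH _ _ _ _ svg).
move=> [xc [[ti tv] tg]] [/= -> ai av ag].
split=> /=; rewrite ?(at_read av) ?(at_read ag) //; first exact: at_keep.
- exact: (at_right _ av).
- exact: (at_right _ ag).
Qed.

Definition rowG (G : 'I_N -> Gc) : seq cell := map encG (tab G).

Lemma size_rowG G : size (rowG G) = N.
Proof. by rewrite size_map size_tab. Qed.

Lemma spec_scanVG (st : nat -> C) (F F' : 'I_N -> Vc) (G G' : 'I_N -> Gc) f zi lg sg :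
  (forall j : 'I_N, f (st j) (F j, G j) = (st j.+1, (F' j, G' j))) ->
  spec (scanVG f)
    (st 0, (zi, tapeV (tab (encV \o F)), (lg, rowG G ++ sg)))
    (st N, (zi, tapeV (tab (encV \o F')), (lg, rowG G' ++ sg))).
Proof.
move=> fE; have := @spec_scanVG_seq f (st 0) zi (tab F) lg (tab G) sg
  (size_tab _) (size_tab _).
rewrite zip_tab (mapacc_tab (st := st) (G := fun j => (F' j, G' j))) //=.
by rewrite /unzip1 /unzip2 /rowG /tab -!map_comp.
Qed.

Lemma spec_fill_row (F : 'I_N -> Vc) f c zi lg :
  spec (fill_row f) (c, (zi, tapeV (tab (encV \o F)), (lg, [::])))
                    (c, (zi, tapeV (tab (encV \o F)), (rev (rowG (f \o F)) ++ lg, [::]))).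
Proof.
rewrite /rowG /tapeV.
apply: spec_seq; last first.
  by apply: spec_loop; apply: spec_left_V; apply: size_tab.
apply: spec_loop; rewrite -[X in spec_iter X](size_enum_ord N) /tab.
elim: (enum _) {1 3}[:: None] lg => [|j s IH] l lg /=; first exact: spec_iter0.
rewrite !rev_cons !cat_rcons; apply: spec_iterS (IH _ _).
move=> [xc [[ti tv] tg]] [/= -> ai av ag].
split=> /=; rewrite ?(at_read av) //; first exact: at_keep.
- exact: (at_right _ av).
- exact: (at_right _ ag).
Qed.

Definition rowsG Y (G : Y -> 'I_N -> Gc) (ys : seq Y) : seq cell :=
  flatten [seq rowG (G y) | y <- ys].

Lemma spec_rewind_G Y (G : Y -> 'I_N -> Gc) (ys : seq Y) c zi zv l s :
  size ys = N ->
  spec rewind_G (c, (zi, zv, (rev (rowsG G ys) ++ l, s)))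
                (c, (zi, zv, (l, rowsG G ys ++ s))).
Proof.
move=> sy; apply: spec_loop; rewrite -[X in spec_iter X]sy.
elim/last_ind: ys s {sy} => [|ys y IH] s; first exact: spec_iter0.
rewrite size_rcons /rowsG map_rcons flatten_rcons rev_cat -!catA.
apply: spec_iterS (IH _); apply: spec_loop; exact: spec_left_G (size_rowG _).
Qed.

(* A row may change the state [x], which determines the control state and the
   contents of the V tape. *)
Lemma spec_for_rows X Y (c : X -> C) (V : X -> 'I_N -> Vc) (G : Y -> 'I_N -> Gc)
    (F : X -> Y -> X * Y) P zi x ys lg sg :
  (forall x y lg sg, spec P
     (c x, (zi, tapeV (tab (encV \o V x)), (lg, rowG (G y) ++ sg)))
     (c (F x y).1, (zi, tapeV (tab (encV \o V (F x y).1)),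
                    (lg, rowG (G (F x y).2) ++ sg)))) ->
  size ys = N ->
  let u := mapacc F x ys in
  spec (for_rows P)
     (c x, (zi, tapeV (tab (encV \o V x)), (lg, rowsG G ys ++ sg)))
     (c u.1, (zi, tapeV (tab (encV \o V u.1)), (lg, rowsG G u.2 ++ sg))).
Proof.
move=> sP sy u; apply: spec_seq; last first.
  by apply: spec_rewind_G; rewrite size_mapacc.
apply: spec_loop; rewrite {}/u -[X in spec_iter X]sy.
elim: ys x lg {sy} => [|y ys IH] x lg; first exact: spec_iter0.
rewrite /= /rowsG /= rev_cat -!catA.
apply: spec_iterS (IH _ _); apply: (spec_seq (sP _ _ _ _)).
by apply: spec_loop; apply: spec_right_G (size_rowG _).
Qed.

(** At the end of a round the matrix is forgotten in this way; the next round overwrites it. *)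
Lemma spec_weaken P a c d zg l s : spec P a (c, (d, (l, s))) -> zg = (l, [::]) ->
  spec P a (c, (d, zg)).
Proof.
move=> sP -> x /sP [? ? ? ?]; split=> //; exact: (@at_weaken _ _ [::] s).
Qed.

End Passes.

(** * Linear equations over Z/qZ *)

Section Elimination.
Local Open Scope ring_scope.
Variable b : nat.
Notation R := 'I_b.+2.

(* [(x, y, z, w)] stands for the matrix with rows [(x, y)] and [(z, w)]. *)
Definition quad := (R * R * R * R)%type.

Definition zeroes (d v : R) (x : quad) : bool :=
  (x.1.1.1 * x.2 - x.1.1.2 * x.1.2 == 1) && (x.1.2 * d + x.2 * v == 0).

(** Over the integers let g = gcd(d, v), d = d' g, v = v' g and u d' + w v' = 1. The rows (u, w) and
    (-v', d') have determinant 1, and the second one sends (d, v) to 0. *)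
Lemma zeroes_exists d v : exists x, zeroes d v x.
Proof.
pose g := gcdz (d : nat)%:Z (v : nat)%:Z.
have [g0|g0] := eqVneq g 0.
  have /eqP := g0; rewrite gcdz_eq0 => /andP[/eqP d0 /eqP v0].
  exists (1, 0, 0, 1); rewrite /zeroes /= !mulr1 mulr0 subr0 eqxx mul0r mul1r.
  by case: v0 => v0; rewrite add0r -val_eqE /= v0.
have [u [w]] := Bezoutz (d : nat)%:Z (v : nat)%:Z; rewrite -/g => uw.
have /dvdzP[d' Ed] := dvdz_gcdl (d : nat)%:Z (v : nat)%:Z.
have /dvdzP[v' Ev] := dvdz_gcdr (d : nat)%:Z (v : nat)%:Z.
rewrite -/g in Ed Ev.
have uw1 : u * d' + w * v' = 1.
  by apply: (mulIf g0); rewrite mul1r mulrDl -!mulrA -Ed -Ev.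
have dE : d = d'%:~R * g%:~R by rewrite -intrM -Ed -pmulrn natr_Zp.
have vE : v = v'%:~R * g%:~R by rewrite -intrM -Ev -pmulrn natr_Zp.
exists (u%:~R, w%:~R, - v'%:~R, d'%:~R); rewrite /zeroes /=.
rewrite mulrN opprK -!intrM -intrD uw1 eqxx /= {1}dE {1}vE.
by apply/eqP; ring.
Qed.

(** A search in a finite set depending on [b] only, so its results can be built into the transition
    table. *)
Definition zeroing (d v : R) : quad := odflt (1, 0, 0, 1) [pick x | zeroes d v x].

Lemma zeroingP d v : zeroes d v (zeroing d v).
Proof.
rewrite /zeroing; case: pickP => [//|no]; have [x] := zeroes_exists d v.
by rewrite no.
Qed.

Definition generates_ann (d t : R) : bool :=
  (t * d == 0) && [forall c, (c * d == 0) ==> [exists k, c == k * t]].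

Lemma mulR_eq0 (c d : R) : (c * d == 0) = (b.+2 %| c * d)%N.
Proof. by rewrite -val_eqE /= /dvdn. Qed.

(** With g = gcd(d, q), q | c d gives q/g | c (d/g), and q/g is coprime to d/g; hence q/g generates
    the annihilator. *)
Lemma generates_ann_exists d : exists t, generates_ann d t.
Proof.
pose g := gcdn d b.+2; have g0 : (0 < g)%N by rewrite gcdn_gt0 orbT.
have gd : (g %| d)%N by apply: dvdn_gcdl.
have gq : (g %| b.+2)%N by apply: dvdn_gcdr.
exists (b.+2 %/ g)%N%:R; apply/andP; split.
  rewrite -[X in _ * X]natr_Zp -natrM -{1}(divnK gd) mulnCA divnK // natrM.
  by rewrite (_ : b.+2%:R = 0 :> R) ?mulr0 //; apply: (@pchar_Zp b.+2).
apply/forallP => c; apply/implyP; rewrite mulR_eq0 => qcd; apply/existsP.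
have /dvdnP[k Ek] : (b.+2 %/ g %| c)%N.
  rewrite -(@Gauss_dvdl _ _ (d %/ g)).
    by rewrite -(@dvdn_pmul2r g) // divnK // -mulnA divnK.
  rewrite /coprime -(eqn_pmul2r g0) muln_gcdl !divnK // mul1n.
  by rewrite gcdnC eqxx.
by exists k%:R; rewrite -natrM -Ek natr_Zp.
Qed.

Definition ann (d : R) : R := odflt 0 [pick t | generates_ann d t].

Lemma annP d : generates_ann d (ann d).
Proof.
rewrite /ann; case: pickP => [//|no]; have [x] := generates_ann_exists d.
by rewrite no.
Qed.

Lemma mul_ann d : ann d * d = 0.
Proof. by have /andP[/eqP] := annP d. Qed.

Lemma ann_gen d c : c * d = 0 -> exists k, c = k * ann d.
Proof.
move=> /eqP cd; have /andP[_ /forallP/(_ c)/implyP/(_ cd)/existsP[k /eqP E]] := annP d.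
by exists k.
Qed.

Variable M : lmodType R.

(** Recursion on the list lets the first generators be exchanged while the combination of the others
    stays untouched. *)
Fixpoint spanned (gs : seq M) (x : M) : Prop :=
  if gs is g :: gs' then exists c : R, spanned gs' (x - c *: g) else x = 0.

Lemma spanned_ind (P : M -> Prop) gs x :
  P 0 -> (forall a u v, P u -> P v -> P (a *: u + v)) ->
  (forall g, List.In g gs -> P g) -> spanned gs x -> P x.
Proof.
move=> P0 PD; elim: gs x => [|g gs IH] x Pg /=; first by move->.
case=> c /IH-/(_ (fun g' h => Pg g' (or_intror h))) Px.
have -> : x = c *: g + (x - c *: g) by rewrite addrC subrK.
by apply: PD => //; apply: Pg; left.
Qed.

Variable phi : M -> R.
Hypothesis phi_lin : forall a u v, phi (a *: u + v) = a * phi u + phi v.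

Definition pair_step (p g : M) : M * M :=
  let: (x, y, z, w) := zeroing (phi p) (phi g) in
  (x *: p + y *: g, z *: p + w *: g).

Definition eliminate (p : M) (gs : seq M) : M * seq M :=
  let u := mapacc pair_step p gs in (ann (phi u.1) *: u.1, u.2).

Lemma phi0 : phi 0 = 0.
Proof.
by have /eqP := phi_lin 1 0 0; rewrite scaler0 addr0 mul1r -subr_eq0 opprD addrA subrr sub0r oppr_eq0 => /eqP.
Qed.

Lemma phiZ a u : phi (a *: u) = a * phi u.
Proof. by rewrite -[a *: u]addr0 phi_lin phi0 addr0. Qed.

Lemma pair_step_zero p g : phi (pair_step p g).2 = 0.
Proof.
rewrite /pair_step; have := zeroingP (phi p) (phi g).
case: (zeroing _ _) => [[[x y] z] w] /andP[_ /eqP/=].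
by rewrite phi_lin phiZ.
Qed.

Lemma pair_step_span p g (x : M) (gs : seq M) :
  spanned [:: p, g & gs] x -> spanned [:: (pair_step p g).1, (pair_step p g).2 & gs] x.
Proof.
rewrite /pair_step; have := zeroingP (phi p) (phi g).
case: (zeroing _ _) => [[[u v] z] w] /andP[/eqP/= det _].
(* The new coefficients are the row (c, e) times the adjugate matrix, which is the inverse as the
   determinant is 1. *)
case=> c [e sp]; exists (c * w - e * z); exists (e * u - c * v).
suff -> : x - (c * w - e * z) *: (u *: p + v *: g)
            - (e * u - c * v) *: (z *: p + w *: g) = x - c *: p - e *: g by [].
rewrite -!addrA; congr (_ + _); rewrite -!opprD; congr (- _).
rewrite !scalerDr !scalerA addrACA -!scalerDl; congr (_ *: _ + _ *: _).
- by rewrite -[RHS]mulr1 -det; ring.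
- by rewrite -[RHS]mulr1 -det; ring.
Qed.

Lemma mapacc_span p gs x :
  spanned (p :: gs) x ->
  spanned ((mapacc pair_step p gs).1 :: (mapacc pair_step p gs).2) x.
Proof.
elim: gs p x => [//|g gs IH] p x /pair_step_span /= [c [e sp]].
have [c' sp'] : spanned ((mapacc pair_step (pair_step p g).1 gs).1
                   :: (mapacc pair_step (pair_step p g).1 gs).2)
                (x - e *: (pair_step p g).2).
  by apply: IH; exists c; rewrite addrAC.
by exists c'; exists e; rewrite addrAC.
Qed.

Lemma mapacc_zero p gs g :
  List.In g (mapacc pair_step p gs).2 -> phi g = 0.
Proof.
elim: gs p => [//|h gs IH] p /= [<-|]; [exact: pair_step_zero | exact: IH].
Qed.

(** After the pass all generators except the pivot p' lie in the kernel. A solution with coefficient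
    c at p' thus has c phi(p') = 0, so c is a multiple of the generator of the annihilator. *)
Lemma eliminate_span p gs x :
  phi x = 0 -> spanned (p :: gs) x ->
  spanned ((eliminate p gs).1 :: (eliminate p gs).2) x.
Proof.
move=> x0 /mapacc_span; rewrite /eliminate.
have := @mapacc_zero p gs.
case: (mapacc _ _ _) => p' gs' /= gs0 [c sp].
have : phi (x - c *: p') = 0.
  apply: (spanned_ind phi0 _ gs0 sp) => a u v u0 v0.
  by rewrite phi_lin u0 v0 mulr0 addr0.
rewrite addrC -scaleNr phi_lin x0 addr0 mulNr => /eqP; rewrite oppr_eq0 => /eqP/ann_gen[k Ek].
by exists k; rewrite scalerA -Ek.
Qed.

(** The inclusion converse to [eliminate_span]; [P] will be the module of solutions of the equations
    imposed earlier. *)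
Lemma eliminate_closed (P : M -> Prop) p gs :
  P 0 -> (forall a u v, P u -> P v -> P (a *: u + v)) ->
  (forall g, List.In g (p :: gs) -> P g) ->
  forall g, List.In g ((eliminate p gs).1 :: (eliminate p gs).2) ->
  P g /\ phi g = 0.
Proof.
move=> P0 PD Pg; rewrite /eliminate.
have PZ a u : P u -> P (a *: u) by move=> Pu; rewrite -[a *: u]addr0; apply: PD.
have main : P (mapacc pair_step p gs).1 /\
    forall g, List.In g (mapacc pair_step p gs).2 -> P g.
  elim: gs p Pg => [|h gs IH] p Pg /=.
    by split => //; apply: Pg; left.
  have Pp : P p by apply: Pg; left.
  have Ph : P h by apply: Pg; right; left.
  have [P1 P2] : P (pair_step p h).1 /\ P (pair_step p h).2.
    rewrite /pair_step; case: (zeroing _ _) => [[[x y] z] w] /=.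
    by split; apply: PD => //; apply: PZ.
  have [|I1 I2] := IH (pair_step p h).1.
    by move=> g [<-//|gin]; apply: Pg; right; right.
  by split => // g [<-//|/I2].
move=> g [<-|gin].
  by split; [apply: PZ; case: main | rewrite phiZ mul_ann].
by split; [case: main => _; apply | apply: mapacc_zero gin].
Qed.

End Elimination.

(** * The decision program *)

Section Algorithm.
Variables (b : nat) (essp : bool).
Notation R := 'I_b.+2.

(* Number of the unary block being read, last input symbol, carry, accumulators,
   verdict. *)
Definition ctl : finType := ('I_7 * bool * bool * (R * R * R) * bool)%type.

(* Cell [j] holds seven marks; whether x_j = 0 has been imposed; whether some
   solution has x_j <> 0; the coefficients of x_j and y_j in the current equation;
   and the values of x_j and y_j in the pivot.  Mark 0 means j < |S|; marks 3, 4
   and 5 designate the source, event and target of the edge being read, and mark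
   6 the index of the round. *)
Definition vcell : finType :=
  ({ffun 'I_7 -> bool} * bool * bool * (R * R) * (R * R))%type.

(* Each row of the matrix holds two generators. *)
Definition gcell : finType := ((R * R) * (R * R))%type.

Definition phase (c : ctl) := c.1.1.1.1.
Definition aux (c : ctl) := c.1.1.2.
Definition regs (c : ctl) := c.1.2.
Definition set_ph x (c : ctl) : ctl := (x, c.1.1.1.2, c.1.1.2, c.1.2, c.2).
Definition set_sym x (c : ctl) : ctl := (c.1.1.1.1, x, c.1.1.2, c.1.2, c.2).
Definition set_aux x (c : ctl) : ctl := (c.1.1.1, x, c.1.2, c.2).
Definition set_regs x (c : ctl) : ctl := (c.1.1, x, c.2).
Definition set_ok x (c : ctl) : ctl := (c.1, x).

Definition track (k : nat) : 'I_7 := inord k.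

Definition marks (v : vcell) k := v.1.1.1.1 (track k).
Definition imposed (v : vcell) := v.1.1.1.2.
Definition separated (v : vcell) := v.1.1.2.
Definition equation (v : vcell) := v.1.2.
Definition pivot (v : vcell) := v.2.

Local Open Scope ring_scope.

Definition cdot (a x : R * R) : R := a.1 * x.1 + a.2 * x.2.
Definition ccomb (x y : R) (p g : R * R) : R * R :=
  (x * p.1 + y * g.1, x * p.2 + y * g.2).

Definition v0 : vcell := ([ffun => false], false, false, (0, 0), (0, 0)).
Definition g0 : gcell := ((0, 0), (0, 0)).

Local Close Scope ring_scope.

Notation cmd := (cmd ctl (vcell + gcell)%type 4).
Notation scanV := (@scanV ctl vcell gcell v0).
Notation scanVG := (@scanVG ctl vcell gcell v0 g0).

(** Adds one to a number. Track 0 holds it in unary, so a mark enters at the left; on the other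
    tracks it is the position of a single mark. *)
Definition shift_track (sel : ctl -> 'I_7) : cmd :=
  Seq (do_ctrl _ _ (fun c => set_aux (sel c == ord0) c))
 (Seq (scanV (fun c v =>
         (set_aux (v.1.1.1.1 (sel c)) c,
          ([ffun k => if k == sel c then aux c else v.1.1.1.1 k],
           imposed v, separated v, equation v, pivot v))))
      (do_ctrl _ _ (set_aux false))).

(** [aux] is true at cell 0 only, where a single mark denotes 0; on track 0 the number 0 has no
    marks. *)
Definition reset (S : pred 'I_7) (full : bool) : cmd :=
  Seq (do_ctrl _ _ (set_aux true))
 (Seq (scanV (fun c v =>
         let m := [ffun k => if S k then (k != ord0) && aux c else v.1.1.1.1 k] in
         (set_aux false c,
          if full then (m, false, false, (0%R, 0%R), (0%R, 0%R))
          else (m, imposed v, separated v, equation v, pivot v))))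
      (do_ctrl _ _ (set_aux false))).

Local Open Scope ring_scope.

Definition row_dots (c : ctl) (x : vcell * gcell) : ctl * (vcell * gcell) :=
  let: (d, v1, v2) := regs c in
  let a := equation x.1 in
  (set_regs (d + cdot a (pivot x.1), v1 + cdot a x.2.1, v2 + cdot a x.2.2) c, x).

(** By linearity [x1 * d + y1 * v1] is the value of the equation at the pivot after the first step,
    so both generators are treated in one pass. *)
Definition row_combine (c : ctl) (x : vcell * gcell) : ctl * (vcell * gcell) :=
  let: (d, v1, v2) := regs c in
  let: (x1, y1, z1, w1) := zeroing d v1 in
  let: (x2, y2, z2, w2) := zeroing (x1 * d + y1 * v1) v2 in
  let p := pivot x.1 in
  let p1 := ccomb x1 y1 p x.2.1 in
  (c, ((x.1.1, ccomb x2 y2 p1 x.2.2),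
       (ccomb z1 w1 p x.2.1, ccomb z2 w2 p1 x.2.2))).

Definition clear_regs : cmd := do_ctrl _ _ (set_regs (0, 0, 0)).

Definition impose : cmd :=
  Seq (for_rows (Seq (scanVG row_dots) (Seq (scanVG row_combine) clear_regs)))
 (Seq (scanV (fun c v =>
         (set_regs ((regs c).1.1 + cdot (equation v) (pivot v), 0, 0) c, v)))
 (Seq (scanV (fun c v =>
         let t := ann (regs c).1.1 in
         (c, (v.1, (t * (pivot v).1, t * (pivot v).2)))))
      clear_regs)).

(** On an edge from a state to itself the marks cancel, as the equation y_e = 0 requires. *)
Definition impose_edge : cmd :=
  Seq (scanV (fun c v =>
         (c, (v.1.1, ((marks v 3)%:R - (marks v 5)%:R, (marks v 4)%:R), v.2))))
      impose.

(** The first scan finds out whether the edge carries the event of the round. For the SSP, x_z = 0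
    is imposed anew at each edge, which is harmless and lets both problems share the program. *)
Definition impose_zero : cmd :=
  Seq (scanV (fun c v => (set_aux (aux c || marks v 4 && marks v 6) c, v)))
 (Seq (scanV (fun c v =>
         let z := if essp then marks v 3 && aux c else marks v 6 in
         (c, (v.1.1.1.1, imposed v || z, separated v, (z%:R, 0), pivot v))))
 (Seq (do_ctrl _ _ (set_aux false))
      impose)).

Local Close Scope ring_scope.

Definition end_of_edge : cmd :=
  Seq impose_edge
 (Seq impose_zero
 (Seq (reset (fun k => 2 < k < 6) false)
      (do_ctrl _ _ (set_ph (track 3))))).

Definition read_symbol : cmd :=
  Seq (read_input _ _ (fun c s => set_sym s c))
 (Seq (If (fun c => c.1.1.1.2) (shift_track phase))
 (Seq (do_ctrl _ _ (fun c =>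
         if c.1.1.1.2 then set_sym false c else set_ph (track (phase c).+1) c))
      (If (fun c => phase c == track 6) end_of_edge))).

(** Track 3 serves as row index; row i receives the unit vectors of x_i and y_i. *)
Definition fill_identity : cmd :=
  Seq (Loop row_clock
         (Seq (fill_row ctl v0 (fun v : vcell =>
                 let m := (marks v 3)%:R%R in ((m, 0%R), (0%R, m)) : gcell))
              (shift_track (fun _ => track 3))))
 (Seq (rewind_G _ _ _) (reset (fun k => 2 < k < 6) false)).

Definition input_clock : 'I_4 := @Ordinal 4 2 isT.
Definition outer_clock : 'I_4 := @Ordinal 4 3 isT.

Definition mark_separated : cmd :=
  for_rows (scanVG (fun c x =>
    (c, ((x.1.1.1.1, separated x.1 || (x.2.1.1 != 0%R) || (x.2.2.1 != 0%R),
          equation x.1, pivot x.1), x.2)))).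

Definition check_separated : cmd :=
  scanV (fun c v =>
    (set_ok (c.2 && (marks v 0 ==> [|| imposed v, separated v | (pivot v).1 != 0%R])) c, v)).

Definition round : cmd :=
  Seq (do_ctrl _ _ (set_ph (track 0)))
 (Seq (reset (fun k => k < 6) true)
 (Seq fill_identity
 (Seq (Loop input_clock read_symbol)
 (Seq (Loop input_clock (shift _ _ _ (MoveL, Stay, Stay)))
 (Seq mark_separated
 (Seq check_separated
      (shift_track (fun _ => track 6)))))))).

Definition algorithm : cmd :=
  Seq (reset predT true) (Loop outer_clock round).

Lemma wf_algorithm : wf 4 algorithm.
Proof. by []. Qed.

End Algorithm.

(** * Correctness of the program *)

Section Correctness.
Variables (b : nat) (essp : bool) (N : nat).
Notation R := 'I_b.+2.
Notation M := ('rV[R]_N * 'rV[R]_N)%type.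
Notation ctl := (ctl b).
Notation vcell := (vcell b).
Notation gcell := (gcell b).
Notation ztape := (ztape (vcell + gcell)%type).
Notation spec := (@spec ctl vcell gcell N).

Definition cellM (x : M) (j : 'I_N) : R * R := (x.1 ord0 j, x.2 ord0 j).

(* The list [n] gives the positions of the marks. *)
Definition track_mark (n : seq nat) (k j : nat) : bool :=
  if k == 0 then j < nth 0 n k else j == nth 0 n k.

Definition vcells (n : seq nat) (o s : 'I_N -> bool) (a p : M) (j : 'I_N) : vcell :=
  ([ffun k : 'I_7 => track_mark n k j], o j, s j, cellM a j, cellM p j).

Definition conf (c : ctl) n o s a p (zi zg : ztape) :=
  (c, (zi, tapeV (tab (@encV vcell gcell \o vcells n o s a p)), zg)).

Lemma vcells_marks n o s a p j k : k < 7 -> marks (vcells n o s a p j) k = track_mark n k j.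
Proof. by move=> k7; rewrite /marks ffunE /track inordK. Qed.

Lemma eq_conf c n o s a p n' o' s' a' p' zi zg :
  vcells n o s a p =1 vcells n' o' s' a' p' ->
  conf c n o s a p zi zg = conf c n' o' s' a' p' zi zg.
Proof.
by move=> E; rewrite /conf; congr (_, (_, tapeV _, _)); apply: eq_tab => j /=; rewrite E.
Qed.

Lemma set_auxK (c : ctl) x : aux c = x -> set_aux x c = c.
Proof. by case: c => [[[[? ?] ?] ?] ?] /= <-. Qed.

Lemma set_regsK (c : ctl) x : regs c = x -> set_regs x c = c.
Proof. by case: c => [[[[? ?] ?] ?] ?] /= <-. Qed.

Lemma spec_shift_track sel (c : ctl) n o s a p zi zg :
  aux c = false -> (forall x, sel (set_aux x c) = sel c) ->
  spec (shift_track sel) (conf c n o s a p zi zg)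
                         (conf c (incr_nth n (sel c)) o s a p zi zg).
Proof.
move=> c0 selE; rewrite /shift_track; apply: spec_ctrl_seq.
(* [aux] holds the old mark of the cell just passed; before cell 0 it is the mark to be inserted. *)
pose st i := set_aux (if i is i'.+1 then track_mark n (sel c) i' else sel c == ord0) c.
rewrite -[c in X in spec _ _ X](set_auxK c0) selE.
apply: (@spec_seq_ctrl _ _ _ _ _ _ _ (st N)).
apply: (spec_scanV (st := st)) => j.
rewrite /decV /= (_ : sel (st j) = sel c); last exact: selE.
congr (_, _); first by rewrite ffunE.
rewrite /vcells /imposed /separated /equation /pivot /=; do 4!congr (_, _).
apply/ffunP => k; rewrite !ffunE; case: eqVneq => [->|ne]; last first.
  have ne' : (sel c == k :> nat) = false by rewrite val_eqE eq_sym (negbTE ne).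
  by rewrite /track_mark nth_incr_nth ne'.
rewrite {1}/track_mark nth_incr_nth eqxx add1n /st /aux /= -val_eqE /=.
case: (j : nat) => [|i] /=; first by case: eqP.
by rewrite /track_mark; case: eqP; rewrite ?ltnS ?eqSS.
Qed.

Definition resetn (S : pred 'I_7) (n : seq nat) : seq nat :=
  mkseq (fun k => if S (track k) then 0 else nth 0 n k) 7.

Lemma spec_reset S (full : bool) (c : ctl) n o s a p zi zg :
  aux c = false ->
  spec (reset b S full) (conf c n o s a p zi zg)
    (if full then conf c (resetn S n) (fun=> false) (fun=> false) 0%R 0%R zi zg
     else conf c (resetn S n) o s a p zi zg).
Proof.
move=> c0; rewrite /reset; apply: spec_ctrl_seq.
pose st i := set_aux (i == 0) c.
rewrite -[c in X in spec _ _ X](set_auxK c0).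
have -> : (if full then
     conf (set_aux false c) (resetn S n) xpred0 xpred0 0%R 0%R zi zg
   else conf (set_aux false c) (resetn S n) o s a p zi zg) =
   (set_aux false (st N), (conf c (resetn S n)
      (fun j => if full then false else o j) (fun j => if full then false else s j)
      (if full then 0%R else a) (if full then 0%R else p) zi zg).2) by case: full.
apply: (@spec_seq_ctrl _ _ _ _ _ _ _ (st N)).
apply: (spec_scanV (st := st)) => j.
have E : [ffun k => if S k then (k != ord0) && aux (st j) else [ffun k : 'I_7 => track_mark n k j] k]
     = [ffun k : 'I_7 => track_mark (resetn S n) k j].
  apply/ffunP => k; rewrite !ffunE /track_mark /resetn nth_mkseq //.
  rewrite /track inord_val; case: ifP => // Sk.
  by rewrite -val_eqE /=; case: eqP.
rewrite /decV /= E; case: full => //=.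
by rewrite /vcells /cellM !mxE.
Qed.

(* At the start, the V tape holds the marks written by [setup_piece]. *)
Lemma spec_reset_all (F : 'I_N -> cell (vcell + gcell)%type) (c : ctl) zi zg :
  aux c = false ->
  spec (reset b predT true) (c, (zi, tapeV (tab F), zg))
    (conf c (nseq 7 0) (fun=> false) (fun=> false) 0%R 0%R zi zg).
Proof.
move=> c0; rewrite /reset; apply: spec_ctrl_seq.
pose st i := set_aux (i == 0) c.
rewrite -[c in X in spec _ _ X](set_auxK c0).
apply: (@spec_seq_ctrl _ _ _ _ _ _ _ (st N)).
apply: (spec_scanV (st := st)) => j.
rewrite /= /vcells /cellM !mxE; congr (_, (_, _, _, _, _)).
apply/ffunP => k; rewrite !ffunE /track_mark.
rewrite (_ : nth _ _ _ = 0); last exact: (etrans (nth_nseq 0 7 0 k) (if_same _ _)).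
by rewrite -val_eqE /=; case: eqP.
Qed.

Local Open Scope ring_scope.

Definition dot (a x : M) : R := \sum_(j < N) cdot (cellM a j) (cellM x j).

(** The accumulator after [i] cells of a pass. *)
Definition dotn (a x : M) (i : nat) : R :=
  \sum_(j < N | (j < i)%N) cdot (cellM a j) (cellM x j).

Lemma dotn0 a x : dotn a x 0 = 0.
Proof. exact: big_pred0. Qed.

Lemma dotnN a x : dotn a x N = dot a x.
Proof. by apply: eq_bigl => j; rewrite ltn_ord. Qed.

Lemma dotnS a x (j : 'I_N) :
  dotn a x j.+1 = dotn a x j + cdot (cellM a j) (cellM x j).
Proof.
rewrite /dotn (bigD1 j) //= addrC; congr (_ + _); apply: eq_bigl => i.
by rewrite ltnS leq_eqVlt -val_eqE /=; case: ltngtP.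
Qed.

Lemma cellM_comb x y (p g : M) j :
  cellM (x *: p + y *: g) j = ccomb x y (cellM p j) (cellM g j).
Proof. by case: p g => [p1 p2] [g1 g2]; congr (_, _); rewrite !mxE. Qed.

Lemma dot_lin a x (u v : M) : dot a (x *: u + v) = x * dot a u + dot a v.
Proof.
rewrite /dot mulr_sumr -big_split /=; apply: eq_bigr => j _.
by rewrite /cdot /cellM !mxE /=; ring.
Qed.

Definition gcells (y : M * M) (j : 'I_N) : gcell := (cellM y.1 j, cellM y.2 j).

Definition flatten_rows (ys : seq (M * M)) : seq M := flatten [seq [:: y.1; y.2] | y <- ys].

Definition row_step a (p : M) (y : M * M) : M * (M * M) :=
  let u1 := pair_step (dot a) p y.1 in
  let u2 := pair_step (dot a) u1.1 y.2 in (u2.1, (u1.2, u2.2)).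

Definition impose_fun a (p : M) (ys : seq (M * M)) : M * seq (M * M) :=
  let u := mapacc (row_step a) p ys in (ann (dot a u.1) *: u.1, u.2).

Lemma impose_eliminate a p ys :
  eliminate (dot a) p (flatten_rows ys) =
  ((impose_fun a p ys).1, flatten_rows (impose_fun a p ys).2).
Proof.
rewrite /eliminate /impose_fun.
suff -> : mapacc (pair_step (dot a)) p (flatten_rows ys) =
   ((mapacc (row_step a) p ys).1, flatten_rows (mapacc (row_step a) p ys).2) by [].
by elim: ys p => //= y ys IH p; rewrite IH.
Qed.

Lemma spec_row c n o s a p y zi lg sg : regs c = (0, 0, 0) ->
  spec (Seq (scanVG (v0 b) (g0 b) (@row_dots b))
          (Seq (scanVG (v0 b) (g0 b) (@row_combine b)) (clear_regs b)))
    (conf c n o s a p zi (lg, rowG vcell (gcells y) ++ sg))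
    (conf c n o s a (row_step a p y).1 zi (lg, rowG vcell (gcells (row_step a p y).2) ++ sg)).
Proof.
move=> c0.
pose st i := set_regs (dotn a p i, dotn a y.1 i, dotn a y.2 i) c.
rewrite -[c in X in spec _ X](set_regsK c0).
apply: (@spec_seq _ _ _ _ _ _ (conf (st N) n o s a p zi (lg, rowG vcell (gcells y) ++ sg))).
  have -> : set_regs (0, 0, 0) c = st 0%N by rewrite /st !dotn0.
  apply: (@spec_scanVG _ _ _ _ _ _ (st)) => j.
  by rewrite /row_dots /st /= -!dotnS.
rewrite -[c in X in spec _ _ X](set_regsK c0).
apply: (@spec_seq_ctrl _ _ _ _ _ _ _ (st N)).
apply: (@spec_scanVG _ _ _ _ _ _ (fun=> st N)) => j.
rewrite /row_combine /st /= !dotnN /row_step /pair_step.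
case: (zeroing (dot a p) (dot a y.1)) => [[[x1 y1] z1] w1] /=.
have -> : dot a (x1 *: p + y1 *: y.1) = x1 * dot a p + y1 * dot a y.1.
  by rewrite dot_lin -[y1 *: y.1]addr0 dot_lin [dot a 0](phi0 (dot_lin a)) addr0.
case: (zeroing _ (dot a y.2)) => [[[x2 y2] z2] w2] /=.
by rewrite /vcells /gcells /= -!cellM_comb.
Qed.

End Correctness.

(** * Imposing the equations of an edge, and reading symbols *)

Section Correctness.
Variables (b : nat) (essp : bool) (N : nat).
Notation R := 'I_b.+2.
Notation M := ('rV[R]_N * 'rV[R]_N)%type.
Notation ctl := (ctl b).
Notation vcell := (vcell b).
Notation gcell := (gcell b).
Notation ztape := (ztape (vcell + gcell)%type).
Notation spec := (@spec ctl vcell gcell N).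
Notation spec_iter := (@spec_iter ctl vcell gcell N).
Local Open Scope ring_scope.

Notation rowsM := (rowsG vcell (@gcells b N)).

Lemma size_impose_fun a p ys : size (impose_fun a p ys : M * seq (M * M)).2 = size ys.
Proof. exact: size_mapacc. Qed.

Lemma spec_impose (c : ctl) n o s a p ys zi lg sg :
  regs c = (0, 0, 0) -> size ys = N ->
  spec (impose b) (conf c n o s a p zi (lg, rowsM ys ++ sg))
    (conf c n o s a (impose_fun a p ys).1 zi
       (lg, rowsM (impose_fun a p ys).2 ++ sg)).
Proof.
move=> c0 sys; rewrite /impose.
apply: spec_seq.
  apply: (@spec_for_rows _ _ _ _ _ _ (fun=> c) (vcells n o s a) (@gcells b N) (row_step a)) sys.
  by move=> *; apply: spec_row.
rewrite /impose_fun; case: (mapacc _ _ _) => p' ys' /=.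
pose st i := set_regs (dotn a p' i, 0, 0) c.
apply: (@spec_seq _ _ _ _ _ _ (conf (st N) n o s a p' zi (lg, rowsM ys' ++ sg))).
  rewrite -[c in X in spec _ X](set_regsK c0).
  have -> : set_regs (0, 0, 0) c = st 0%N by rewrite /st !dotn0.
  apply: (spec_scanV (st := st)) => j.
  by rewrite /st /= -!dotnS.
rewrite -[c in X in spec _ _ X](set_regsK c0).
apply: (@spec_seq_ctrl _ _ _ _ _ _ _ (st N)).
apply: (spec_scanV (st := fun=> st N)) => j.
rewrite /st /= dotnN /vcells /=; congr (_, (_, _)).
by rewrite /cellM; case: p' {st} => p1 p2; congr (_, _); rewrite !mxE.
Qed.

Definition edge_eq (s e t : nat) : M :=
  (\row_(j < N) ((j == s :> nat)%:R - (j == t :> nat)%:R),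
   \row_(j < N) (j == e :> nat)%:R).

(* The variables x_j set to zero in round [z] on reading an edge (s, e, t): the
   sources of event [z] for the ESSP, and state [z] for the SSP. *)
Definition zero_set (z s e j : nat) : bool :=
  if essp then (j == s) && (e == z) else j == z.

Definition zero_eq (z s e : nat) : M := (\row_(j < N) (zero_set z s e j)%:R, 0).

(** What an edge acts on: the variables set to zero so far, the last equation, the pivot and the
    rows of generators. *)
Definition store := (('I_N -> bool) * M * M * seq (M * M))%type.

Definition edge_fun (z s e t : nat) (x : store) : store :=
  let: (o, a, p, ys) := x in
  let u1 := impose_fun (edge_eq s e t) p ys in
  let u2 := impose_fun (zero_eq z s e) u1.1 u1.2 in
  (fun j => o j || zero_set z s e j, zero_eq z s e, u2.1, u2.2).

Definition store_conf (c : ctl) n s (x : store) zi :=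
  let: (o, a, p, ys) := x in
  conf c n o s a p zi ([:: None], rowsM ys ++ [::]).

Definition ctl_at (k : nat) (ok : bool) : ctl := (track k, false, false, (0, 0, 0), ok).

Lemma spec_end_of_edge k ok n0 n1 n2 s e t z sp x zi : (z < N)%N -> size x.2 = N ->
  spec (end_of_edge b essp)
    (store_conf (ctl_at k ok) [:: n0; n1; n2; s; e; t; z] sp x zi)
    (store_conf (ctl_at 3 ok) [:: n0; n1; n2; 0%N; 0%N; 0%N; z] sp (edge_fun z s e t x) zi).
Proof.
move: x => [[[o a] p] ys] /= zN sys; rewrite /end_of_edge.
set n := [:: n0; _; _; _; _; _; _].
set u1 := impose_fun (edge_eq s e t) p ys.
have su1 : size u1.2 = N by rewrite size_impose_fun.
set u2 := impose_fun (zero_eq z s e) u1.1 u1.2.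
apply: (@spec_seq _ _ _ _ _ _ (store_conf (ctl_at k ok) n sp (o, edge_eq s e t, u1.1, u1.2) zi)).
  rewrite /impose_edge; apply: spec_seq; last exact: spec_impose.
  apply: (spec_scanV (st := fun=> ctl_at k ok)) => j.
  rewrite /= !vcells_marks // /vcells /cellM !mxE /track_mark /=.
  by [].
pose o' (j : 'I_N) := o j || zero_set z s e j.
apply: (@spec_seq _ _ _ _ _ _ (store_conf (ctl_at k ok) n sp (o', zero_eq z s e, u2.1, u2.2) zi)).
  rewrite /impose_zero.
  pose st i := set_aux ((e == z) && (e < i)%N) (ctl_at k ok).
  apply: (@spec_seq _ _ _ _ _ _ (store_conf (st N) n sp (o, edge_eq s e t, u1.1, u1.2) zi)).
    have -> : ctl_at k ok = st 0%N by rewrite /st ltn0 andbF.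
    apply: (spec_scanV (st := st)) => j.
    rewrite /= !vcells_marks // /track_mark /= /st /set_aux /aux /=; congr (_, _, _, _, _).
    rewrite ltnS; case: (ltngtP e j) => [ej|je|<-] /=.
    - by rewrite andbT orbF.
    - by rewrite andbF.
    - by rewrite andbF andbT.
  apply: (@spec_seq _ _ _ _ _ _ (store_conf (st N) n sp (o', zero_eq z s e, u1.1, u1.2) zi)).
    apply: (spec_scanV (st := fun=> st N)) => j.
    rewrite /= !vcells_marks // /track_mark /= /vcells /o' /zero_eq /zero_set /cellM /= !mxE /aux /=.
    (* As z < N, the mark of an event equal to z lies on the tape, and the scan has met it. *)
    have -> : (e == z) && (e < N)%N = (e == z).
      by case: eqP => [->|].
    by [].
  by apply: spec_ctrl_seq; apply: spec_impose.
apply: (@spec_seq_ctrl _ _ _ _ _ _ _ (ctl_at k ok)).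
have := @spec_reset b N (fun k => 2 < k < 6)%N false (ctl_at k ok) n o' sp (zero_eq z s e) u2.1 zi
  ([:: None], rowsM u2.2 ++ [::]) erefl.
by rewrite /resetn /mkseq /= /track !inordK.
Qed.

Local Close Scope ring_scope.

Definition input_cell (x : bool) : cell (vcell + gcell)%type := Some (inl x).

Lemma track_eq i j : i < 7 -> j < 7 -> (track i == track j) = (i == j).
Proof. by move=> i7 j7; rewrite -val_eqE /= !inordK. Qed.

Lemma spec_read_one k ok n s x l r : k < 6 ->
  spec (read_symbol b essp)
    (store_conf (ctl_at k ok) n s x (l, input_cell true :: r))
    (store_conf (ctl_at k ok) (incr_nth n k) s x (input_cell true :: l, r)).
Proof.
move: x => [[[o a] p] ys] k6; rewrite /read_symbol.
pose c := set_sym true (ctl_at k ok).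
apply: (@spec_seq _ _ _ _ _ _ (store_conf c n s (o, a, p, ys) (input_cell true :: l, r))).
  exact: spec_read_input.
apply: (@spec_seq _ _ _ _ _ _ (store_conf c (incr_nth n k) s (o, a, p, ys) (input_cell true :: l, r))).
  apply: spec_if => /=.
  have -> : incr_nth n k = incr_nth n (phase c) by rewrite /= /track inordK // ltnW.
  exact: spec_shift_track.
apply: spec_ctrl_seq; apply: spec_if => /=.
by rewrite /phase /= track_eq ?(ltn_eqF k6) // ltnW.
Qed.

Lemma spec_read_zero k ok n s x l r : k < 5 ->
  spec (read_symbol b essp)
    (store_conf (ctl_at k ok) n s x (l, input_cell false :: r))
    (store_conf (ctl_at k.+1 ok) n s x (input_cell false :: l, r)).
Proof.
move: x => [[[o a] p] ys] k5; rewrite /read_symbol.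
apply: (@spec_seq _ _ _ _ _ _ (store_conf (ctl_at k ok) n s (o, a, p, ys) (input_cell false :: l, r))).
  exact: spec_read_input.
apply: (@spec_seq _ _ _ _ _ _ (store_conf (ctl_at k ok) n s (o, a, p, ys) (input_cell false :: l, r))).
  by apply: spec_if.
have k7 : k < 7 by apply: leq_trans k5 _.
apply: spec_ctrl_seq; apply: spec_if => /=.
rewrite /phase /= [val (track k)]inordK //.
by rewrite track_eq ?(ltn_eqF (k5 : k.+1 < 6)) // !ltnS (leq_trans (ltnW k5)).
Qed.

Lemma spec_read_last ok n0 n1 n2 s e t z sp x l r : z < N -> size x.2 = N ->
  spec (read_symbol b essp)
    (store_conf (ctl_at 5 ok) [:: n0; n1; n2; s; e; t; z] sp x (l, input_cell false :: r))
    (store_conf (ctl_at 3 ok) [:: n0; n1; n2; 0; 0; 0; z] sp (edge_fun z s e t x)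
       (input_cell false :: l, r)).
Proof.
move=> zN sx; rewrite /read_symbol.
apply: (@spec_seq _ _ _ _ _ _ (store_conf (ctl_at 5 ok) [:: n0; n1; n2; s; e; t; z] sp x (input_cell false :: l, r))).
  by case: x sx => [[[o a] p] ys] _; apply: spec_read_input.
apply: spec_seq; first by apply: spec_if; case: x sx => [[[o a] p] ys].
apply: (@spec_seq _ _ _ _ _ _ (store_conf (ctl_at 6 ok) [:: n0; n1; n2; s; e; t; z] sp x (input_cell false :: l, r))).
  case: x sx => [[[o a] p] ys] _.
  have -> : ctl_at 6 ok = set_ph (track (phase (ctl_at 5 ok)).+1) (ctl_at 5 ok).
    by rewrite /phase /= [val (track 5)]inordK.
  exact: spec_ctrl.
apply: spec_if.
have -> : phase (store_conf (ctl_at 6 ok) [:: n0; n1; n2; s; e; t; z] sp x (input_cell false :: l, r)).1 = track 6.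
  by case: x sx => [[[o a] p] ys].
by rewrite eqxx; apply: spec_end_of_edge.
Qed.

Lemma iter_incr_nth k n i : i < size n ->
  iter k (incr_nth^~ i) n = set_nth 0 n i (k + nth 0 n i).
Proof.
move=> si; apply: (@eq_from_nth _ 0).
  rewrite size_set_nth (maxn_idPr si).
  by elim: k => //= k IH; rewrite size_incr_nth IH si.
move=> j _; rewrite nth_set_nth /=; elim: k => [|k IH] /=.
  by case: eqP => [->|].
by rewrite nth_incr_nth {}IH eq_sym; case: eqP => _; rewrite ?add1n.
Qed.

Lemma spec_read_ones m k ok n s x l r : k < 6 ->
  spec_iter m (read_symbol b essp)
    (store_conf (ctl_at k ok) n s x (l, nseq m (input_cell true) ++ r))
    (store_conf (ctl_at k ok) (iter m (incr_nth^~ k) n) s x (nseq m (input_cell true) ++ l, r)).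
Proof.
move=> k6; elim: m n l => [|m IH] n l; first exact: spec_iter0.
rewrite [nseq m.+1 _ ++ l](_ : _ = nseq m (input_cell true) ++ input_cell true :: l); last first.
  by elim: m {IH} => //= m ->.
rewrite iterSr; apply: spec_iterS; [exact: spec_read_one|exact: IH].
Qed.

End Correctness.

(** * Reading the input and running all rounds *)

Section Correctness.
Variables (b : nat) (essp : bool) (N : nat).
Notation R := 'I_b.+2.
Notation M := ('rV[R]_N * 'rV[R]_N)%type.
Notation ctl := (ctl b).
Notation vcell := (vcell b).
Notation gcell := (gcell b).
Notation ztape := (ztape (vcell + gcell)%type).
Notation spec := (@spec ctl vcell gcell N).
Notation spec_iter := (@spec_iter ctl vcell gcell N).

Notation rowsM := (rowsG vcell (@gcells b N)).

Lemma spec_unary m k ok n s (x : store b N) l r : k < 5 -> k < size n -> nth 0 n k = 0 ->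
  spec_iter (size (unary m)) (read_symbol b essp)
    (store_conf (ctl_at b k ok) n s x (l, map (@input_cell b) (unary m) ++ r))
    (store_conf (ctl_at b k.+1 ok) (set_nth 0 n k m) s x (rev (map (@input_cell b) (unary m)) ++ l, r)).
Proof.
move=> k5 kn n0; rewrite /unary size_rcons size_nseq map_rcons cat_rcons map_nseq rev_rcons.
rewrite rev_nseq -addn1; apply: spec_iterD; first by apply: spec_read_ones; apply: ltnW.
rewrite iter_incr_nth // n0 addn0; apply: spec_iterS; last exact: spec_iter0.
exact: spec_read_zero.
Qed.

Lemma spec_unary_last ok n0 n1 n2 s e t z sp (x : store b N) l r : z < N -> size x.2 = N ->
  spec_iter (size (unary t)) (read_symbol b essp)
    (store_conf (ctl_at b 5 ok) [:: n0; n1; n2; s; e; 0; z] sp x (l, map (@input_cell b) (unary t) ++ r))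
    (store_conf (ctl_at b 3 ok) [:: n0; n1; n2; 0; 0; 0; z] sp (edge_fun essp z s e t x)
       (rev (map (@input_cell b) (unary t)) ++ l, r)).
Proof.
move=> zN sx; rewrite /unary size_rcons size_nseq map_rcons cat_rcons map_nseq rev_rcons.
rewrite rev_nseq -addn1; apply: spec_iterD; first exact: spec_read_ones.
rewrite iter_incr_nth //= addn0; apply: spec_iterS; last exact: spec_iter0.
exact: spec_read_last.
Qed.

Definition edge_code (u : nat * nat * nat) : seq bool :=
  flatten [seq unary k | k <- [:: u.1.1; u.1.2; u.2]].

Definition edge_step z (x : store b N) (u : nat * nat * nat) : store b N :=
  edge_fun essp z u.1.1 u.1.2 u.2 x.

Lemma size_edge_step z x u : size x.2 = N -> size (edge_step z x u).2 = N.
Proof.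
by case: x => [[[o a] p] ys] /= sys; rewrite !size_impose_fun.
Qed.

Lemma spec_edge ok n0 n1 n2 z u sp (x : store b N) l r : z < N -> size x.2 = N ->
  spec_iter (size (edge_code u)) (read_symbol b essp)
    (store_conf (ctl_at b 3 ok) [:: n0; n1; n2; 0; 0; 0; z] sp x
       (l, map (@input_cell b) (edge_code u) ++ r))
    (store_conf (ctl_at b 3 ok) [:: n0; n1; n2; 0; 0; 0; z] sp (edge_step z x u)
       (rev (map (@input_cell b) (edge_code u)) ++ l, r)).
Proof.
case: u => [[s e] t] zN sx; rewrite /edge_code /= cats0 !map_cat !rev_cat -!catA !size_cat.
apply: spec_iterD; first exact: spec_unary.
by apply: spec_iterD; [exact: spec_unary|exact: spec_unary_last].
Qed.

Lemma spec_edges L ok n0 n1 n2 z sp (x : store b N) l r : z < N -> size x.2 = N ->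
  let w := flatten [seq edge_code u | u <- L] in
  spec_iter (size w) (read_symbol b essp)
    (store_conf (ctl_at b 3 ok) [:: n0; n1; n2; 0; 0; 0; z] sp x (l, map (@input_cell b) w ++ r))
    (store_conf (ctl_at b 3 ok) [:: n0; n1; n2; 0; 0; 0; z] sp (foldl (edge_step z) x L)
       (rev (map (@input_cell b) w) ++ l, r)).
Proof.
move=> zN; elim: L x l => [|u L IH] x l sx /=; first exact: spec_iter0.
rewrite size_cat map_cat rev_cat -!catA; apply: spec_iterD; first exact: spec_edge.
by apply: IH; apply: size_edge_step.
Qed.

Definition ts_code (nS nE i : nat) (L : seq (nat * nat * nat)) : seq bool :=
  unary nS ++ unary nE ++ unary i ++ flatten [seq edge_code u | u <- L].

Lemma spec_input nS nE i L ok z sp (x : store b N) l r : z < N -> size x.2 = N ->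
  let w := ts_code nS nE i L in
  spec_iter (size w) (read_symbol b essp)
    (store_conf (ctl_at b 0 ok) [:: 0; 0; 0; 0; 0; 0; z] sp x (l, map (@input_cell b) w ++ r))
    (store_conf (ctl_at b 3 ok) [:: nS; nE; i; 0; 0; 0; z] sp (foldl (edge_step z) x L)
       (rev (map (@input_cell b) w) ++ l, r)).
Proof.
move=> zN sx /=; rewrite /ts_code !map_cat !rev_cat -!catA !size_cat.
apply: spec_iterD; first exact: spec_unary.
apply: spec_iterD; first exact: spec_unary.
apply: spec_iterD; first exact: spec_unary.
exact: spec_edges.
Qed.

Definition unit_row (i : nat) : 'rV[R]_N := (\row_(j < N) (j == i :> nat)%:R)%R.

Definition unit_rows (i : nat) : M * M := ((unit_row i, 0%R), (0%R, unit_row i)).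

Lemma spec_fill_identity k ok z (o s : 'I_N -> bool) (a p : M) zi :
  spec (fill_identity b)
    (conf (ctl_at b k ok) [:: 0; 0; 0; 0; 0; 0; z] o s a p zi ([:: None], [::]))
    (conf (ctl_at b k ok) [:: 0; 0; 0; 0; 0; 0; z] o s a p zi
       ([:: None], rowsM (mkseq unit_rows N) ++ [::])).
Proof.
rewrite /fill_identity.
pose st i := conf (ctl_at b k ok) [:: 0; 0; 0; i; 0; 0; z] o s a p zi
   (rev (rowsM (mkseq unit_rows i)) ++ [:: None], [::]).
apply: (@spec_seq _ _ _ _ _ _ (st N)).
  apply: spec_loop; apply: (@spec_iter_nat _ _ _ _ _ _ st) => i _; rewrite /st.
  apply: (@spec_seq _ _ _ _ _ _ (conf (ctl_at b k ok) [:: 0; 0; 0; i; 0; 0; z] o s a p zi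
   (rev (rowsM (mkseq unit_rows i.+1)) ++ [:: None], [::]))).
    have -> : rowsM (mkseq unit_rows i.+1) = rowsM (mkseq unit_rows i) ++
        rowG vcell ((fun v : vcell => let m := (marks v 3)%:R%R in ((m, 0%R), (0%R, m)) : gcell)
          \o vcells [:: 0; 0; 0; i; 0; 0; z] o s a p).
      rewrite /rowsG mkseqS map_rcons flatten_rcons; congr (_ ++ map _ _).
      apply: eq_tab => j; rewrite /= vcells_marks // /track_mark /gcells /cellM !mxE /=.
      by [].
    rewrite rev_cat -catA; exact: spec_fill_row.
  have := @spec_shift_track b N (fun=> track 3) (ctl_at b k ok) [:: 0; 0; 0; i; 0; 0; z] o s a p zi
    (rev (rowsM (mkseq unit_rows i.+1)) ++ [:: None], [::]) erefl (fun=> erefl).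
  by rewrite /track inordK.
apply: spec_seq; first by apply: spec_rewind_G; rewrite size_mkseq.
have := @spec_reset b N (fun k => 2 < k < 6) false (ctl_at b k ok) [:: 0; 0; 0; N; 0; 0; z] o s a p zi
  ([:: None], rowsM (mkseq unit_rows N) ++ [::]) erefl.
by rewrite /resetn /mkseq /= /track !inordK.
Qed.

Definition separates (j : 'I_N) (x : M) : bool := x.1 ord0 j != 0%R.

Lemma spec_mark_separated c n (o s : 'I_N -> bool) (a p : M) ys zi lg sg : size ys = N ->
  spec (mark_separated b) (conf c n o s a p zi (lg, rowsM ys ++ sg))
    (conf c n o (fun j => s j || has (separates j) (flatten_rows ys)) a p zi (lg, rowsM ys ++ sg)).
Proof.
move=> sys.
pose F (s : 'I_N -> bool) (y : M * M) :=
  ((fun j => s j || separates j y.1 || separates j y.2), y).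
have -> : conf c n o (fun j => s j || has (separates j) (flatten_rows ys)) a p zi (lg, rowsM ys ++ sg)
   = conf c n o (mapacc F s ys).1 a p zi (lg, rowsM (mapacc F s ys).2 ++ sg).
  have -> : (mapacc F s ys).2 = ys by elim: (ys) (s) => //= y ys' IH s'; rewrite IH.
  apply: eq_conf => j; congr (_, _, _, _, _).
  elim: (ys) (s) => [|y ys' IH] s' /=; first by rewrite orbF.
  by rewrite -IH /= !orbA.
apply: (@spec_for_rows _ _ _ _ _ _ (fun=> c) (fun s => vcells n o s a p) (@gcells b N) F) sys.
move=> s' y lg' sg'; apply: (@spec_scanVG _ _ _ _ _ _ (fun=> c)) => j.
by [].
Qed.

Definition all_separated nS (x : store b N) : bool :=
  [forall j : 'I_N, (j < nS) ==>
     [|| x.1.1.1 j, has (separates j) (flatten_rows x.2) | separates j x.1.2]].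

Lemma spec_check_separated k ok n x zi :
  spec (check_separated b)
    (store_conf (ctl_at b k ok) n (fun j => false || has (separates j) (flatten_rows x.2)) x zi)
    (store_conf (ctl_at b k (ok && all_separated (nth 0 n 0) x)) n
        (fun j => false || has (separates j) (flatten_rows x.2)) x zi).
Proof.
case: x => [[[o a] p] ys] /=.
pose chk (j : 'I_N) := (j < nth 0 n 0) ==>
   [|| o j, has (separates j) (flatten_rows ys) | separates j p].
pose st i := ctl_at b k (ok && [forall j : 'I_N, (j < i) ==> chk j]).
have -> : ctl_at b k ok = st 0.
  by rewrite /st; have -> : [forall j : 'I_N, (j < 0) ==> chk j]; [apply/forallP|rewrite andbT].
have -> : ctl_at b k (ok && all_separated (nth 0 n 0) (o, a, p, ys)) = st N.
  rewrite /st; congr (ctl_at _ _ (_ && _)); apply: eq_forallb => j.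
  by rewrite ltn_ord.
apply: (spec_scanV (st := st)) => j.
rewrite /= vcells_marks // /track_mark /= /st /set_ok /ctl_at /=; congr (_, _, _).
rewrite -andbA; congr (_ && _).
apply/andP/forallP => [[/forallP H c] i|H].
  apply/implyP; rewrite ltnS leq_eqVlt => /orP[/eqP/val_inj->//|ij].
  exact: (implyP (H i)).
split; last exact: (implyP (H j)).
by apply/forallP => i; apply/implyP => ij; apply: (implyP (H i)); rewrite ltnS ltnW.
Qed.

Definition store0 : store b N := (fun=> false, 0%R, 0%R, mkseq unit_rows N).

Definition round_ok nS L (z : nat) : bool :=
  all_separated nS (foldl (edge_step z) store0 L).

Section Word.
Variables (nS nE i : nat) (L : seq (nat * nat * nat)).
Hypothesis size_w : size (ts_code nS nE i L) = N.

Let zin : ztape := ([:: None], map (@input_cell b) (ts_code nS nE i L) ++ [:: None]).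

(** What remains in the cells of the V tape is existential: the next round resets all of it but
    track 6, the index of the round. *)
Lemma spec_round k ok n (o s : 'I_N -> bool) (a p : M) : size n = 7 -> nth 0 n 6 < N ->
  exists (o' s' : 'I_N -> bool) (a' p' : M),
  spec (round b essp) (conf (ctl_at b k ok) n o s a p zin ([:: None], [::]))
    (conf (ctl_at b 3 (ok && round_ok nS L (nth 0 n 6))) [:: nS; nE; i; 0; 0; 0; (nth 0 n 6).+1]
      o' s' a' p' zin ([:: None], [::])).
Proof.
move=> sn zN; set z := nth 0 n 6.
set x := foldl (edge_step z) store0 L.
have sx : size x.2 = N.
  have: size store0.2 = N by rewrite size_mkseq.
  rewrite /x; elim: (L) store0 => //= u L' IH y sy; apply: IH; exact: size_edge_step.
exists x.1.1.1, (fun j => false || has (separates j) (flatten_rows x.2)), x.1.1.2, x.1.2.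
rewrite /round; apply: spec_ctrl_seq.
apply: (@spec_seq _ _ _ _ _ _ (conf (ctl_at b 0 ok) [:: 0; 0; 0; 0; 0; 0; z]
  (fun=> false) (fun=> false) 0%R 0%R zin ([:: None], [::]))).
  have := @spec_reset b N (fun k => k < 6) true (ctl_at b 0 ok) n o s a p zin ([:: None], [::]) erefl.
  rewrite /resetn /mkseq /= /track !inordK //; exact.
apply: spec_seq; first exact: spec_fill_identity.
apply: (@spec_seq _ _ _ _ _ _ (store_conf (ctl_at b 3 ok) [:: nS; nE; i; 0; 0; 0; z] (fun=> false) x
   (rev (map (@input_cell b) (ts_code nS nE i L)) ++ [:: None], [:: None]))).
  apply: spec_loop; rewrite -[X in spec_iter X]size_w.
  rewrite -[conf _ _ _ _ _ _ _ _]/(store_conf (ctl_at b 0 ok) [:: 0; 0; 0; 0; 0; 0; z]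
    (fun=> false) store0 zin).
  by apply: spec_input => //; rewrite /= size_mkseq.
apply: (@spec_seq _ _ _ _ _ _ (store_conf (ctl_at b 3 ok) [:: nS; nE; i; 0; 0; 0; z] (fun=> false) x zin)).
  case: (x) => [[[o' a'] p'] ys]; apply: spec_loop.
  by apply: spec_left_input; rewrite size_map.
apply: (@spec_seq _ _ _ _ _ _ (store_conf (ctl_at b 3 ok) [:: nS; nE; i; 0; 0; 0; z]
   (fun j => false || has (separates j) (flatten_rows x.2)) x zin)).
  by case: (x) sx => [[[o' a'] p'] ys] sys; apply: spec_mark_separated.
apply: spec_seq; first exact: spec_check_separated.
rewrite -/(round_ok nS L z) /=.
have := @spec_shift_track b N (fun=> track 6) (ctl_at b 3 (ok && round_ok nS L z))
  [:: nS; nE; i; 0; 0; 0; z] x.1.1.1 (fun j => false || has (separates j) (flatten_rows x.2))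
   x.1.1.2 x.1.2 zin ([:: None], rowsM x.2 ++ [::]) erefl (fun=> erefl).
rewrite /track inordK //= => H.
move: H; case: (x) => [[[o' a'] p'] ys] H.
exact: spec_weaken H erefl.
Qed.

Theorem algorithm_correct :
  (sem N (algorithm b essp) (ctl_at b 0 true, inputs _ (ts_code nS nE i L))).1.2
  = [forall z : 'I_N, round_ok nS L z].
Proof.
set x0 := (_, _).
pose ok z := [forall y : 'I_N, (y < z) ==> round_ok nS L y].
(* The setup has left marks on the V and G tapes; nothing is claimed about the cells right of the G
   head. *)
have r0 : rep x0 (ctl_at b 0 true, (zin, tapeV (tab (fun _ : 'I_N => mark _)), ([:: None], [::]))).
  split => //=; split=> //.
  - by exists [::]; rewrite cats0.
  - exists [::]; rewrite cats0 size_w /tapeV /tab; congr (_ ++ _).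
    by rewrite -[X in nseq X]size_enum_ord; elim: (enum _) => //= j s ->.
  - by eexists.
have r1 : rep (sem N (reset b predT true) x0)
   (conf (ctl_at b 0 true) (nseq 7 0) (fun _ : 'I_N => false) (fun=> false) 0%R 0%R zin ([:: None], [::])).
  exact: spec_reset_all r0.
set x1 := sem N _ x0 in r1.
rewrite -[(sem N (algorithm b essp) x0).1]/(iter N (fun y => sem N (round b essp) (keep y)) x1).1.
have inv z : z <= N -> exists k n (o s : 'I_N -> bool) (a p : M), [/\ size n = 7, nth 0 n 6 = z &
   rep (iter z (fun y => sem N (round b essp) (keep y)) x1)
     (conf (ctl_at b k (ok z)) n o s a p zin ([:: None], [::]))].
  elim: z => [_|z IH zN].
    exists 0, (nseq 7 0), (fun=> false), (fun=> false), 0%R, 0%R; split; [by []|by []|].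
    by have -> : ok 0 by apply/forallP.
  have [k [n [o [s [a [p [sn nz rz]]]]]]] := IH (ltnW zN).
  have zN' : nth 0 n 6 < N by rewrite nz.
  have [o' [s' [a' [p' sp]]]] := spec_round k (ok z) o s a p sn zN'.
  exists 3, [:: nS; nE; i; 0; 0; 0; z.+1], o', s', a', p'; split; [by []|by []|].
  have -> : ok z.+1 = ok z && round_ok nS L z.
    apply/forallP/andP => [H|[/forallP H c] y].
      split; last exact: (implyP (H (Ordinal zN))).
      by apply/forallP => y; apply/implyP => yz; apply: (implyP (H y)); rewrite ltnS ltnW.
    apply/implyP; rewrite ltnS leq_eqVlt => /orP[/eqP->//|yz].
    exact: (implyP (H y)).
  by move: sp; rewrite nz; apply; apply: rep_keep.
have [k [n [o [s [a [p [_ _ [-> _ _ _]]]]]]]] := inv N (leqnn N).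
by apply: eq_forallb => y; rewrite ltn_ord.
Qed.

End Word.
End Correctness.

(** * The solutions found by a round *)

Section Rounds.
Variables (b : nat) (essp : bool) (N : nat).
Notation R := 'I_b.+2.
Notation M := ('rV[R]_N * 'rV[R]_N)%type.
Local Open Scope ring_scope.

Definition solution (z : nat) (L : seq (nat * nat * nat)) (x : M) : Prop :=
  forall u, u \in L -> dot (edge_eq b N u.1.1 u.1.2 u.2) x = 0 /\
                       dot (zero_eq b essp N z u.1.1 u.1.2) x = 0.

Lemma solution_lin z L a (u v : M) :
  solution z L u -> solution z L v -> solution z L (a *: u + v).
Proof.
move=> su sv w wL; have [u1 u2] := su w wL; have [v1 v2] := sv w wL.
by rewrite !dot_lin u1 u2 v1 v2 !mulr0 !addr0.
Qed.

Lemma dot0 (a : M) : dot a 0 = 0.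
Proof. exact: phi0 (dot_lin a). Qed.

Lemma solution0 z L : solution z L 0.
Proof. by move=> u _; rewrite !dot0. Qed.

Lemma solution_rcons z L u x : solution z (rcons L u) x <->
  [/\ solution z L x, dot (edge_eq b N u.1.1 u.1.2 u.2) x = 0 &
      dot (zero_eq b essp N z u.1.1 u.1.2) x = 0].
Proof.
split=> [H|[H1 H2 H3] v].
  have [|H2 H3] := H u; first by rewrite mem_rcons mem_head.
  by split=> // v vL; apply: H; rewrite mem_rcons inE vL orbT.
by rewrite mem_rcons inE => /orP[/eqP->//|/H1].
Qed.

(** For the induction, the list contains the support of [x]; the two coordinates at one index are
    subtracted at a time. *)
Lemma span_unit_rows_on (s : seq 'I_N) (x : M) :
  (forall j, j \notin s -> cellM x j = (0, 0)) ->
  spanned (flatten_rows [seq unit_rows b N (val j) | j <- s]) x.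
Proof.
elim: s x => [|j s IH] x x0 /=.
  case: x x0 => x1 x2 x0; congr (_, _); apply/rowP => j; rewrite mxE;
    by case: (x0 j isT).
exists (x.1 ord0 j), (x.2 ord0 j); apply: IH => k ks.
case: x x0 => x1 x2 x0.
transitivity (x1 ord0 k - x1 ord0 j * (k == j :> nat)%:R,
              x2 ord0 k - x2 ord0 j * (k == j :> nat)%:R).
  by congr (_, _) => /=; rewrite !mxE mulr0 subr0.
have [->|kj] := eqVneq k j; first by rewrite eqxx !mulr1 !subrr.
rewrite (_ : (k == j :> nat) = false); last exact: negbTE.
have [->  ->] : x1 ord0 k = 0 /\ x2 ord0 k = 0.
  have : k \notin j :: s by rewrite inE negb_or kj ks.
  by case/x0.
by rewrite !mulr0 !subr0.
Qed.

(** The initial pivot 0 adds nothing to the free module and fills the place of the extra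
    generator. *)
Lemma span_unit_rows (x : M) :
  spanned (0 :: flatten_rows (mkseq (@unit_rows b N) N)) x.
Proof.
exists 0; rewrite scale0r subr0.
have -> : mkseq (@unit_rows b N) N = [seq unit_rows b N (val j) | j <- enum 'I_N].
  by rewrite [RHS]map_comp val_enum_ord.
by apply: span_unit_rows_on => j; rewrite mem_enum.
Qed.

Definition gens (x : store b N) : seq M := x.1.2 :: flatten_rows x.2.

Lemma gens_edge_step z x u :
  exists p ys, eliminate (dot (edge_eq b N u.1.1 u.1.2 u.2)) x.1.2 (flatten_rows x.2) = (p, flatten_rows ys) /\
  exists p' ys', eliminate (dot (zero_eq b essp N z u.1.1 u.1.2)) p (flatten_rows ys) = (p', flatten_rows ys') /\
  gens (edge_step essp z x u) = p' :: flatten_rows ys'.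
Proof.
case: x => [[[o a] p] ys] /=; rewrite impose_eliminate; do 2!eexists; split; first reflexivity.
by rewrite impose_eliminate; do 2!eexists; split; first reflexivity.
Qed.

(** The invariant over the edges read: the generators lie in the solution module by
    [eliminate_closed] and exhaust it by [eliminate_span], each applied to the edge equation and
    then to the zero equation. *)
Lemma gens_correct z L : let st := foldl (edge_step essp z) (store0 b N) L in
  [/\ forall j, st.1.1.1 j = has (fun u => zero_set essp z u.1.1 u.1.2 j) L,
      forall g, List.In g (gens st) -> solution z L g &
      forall x, solution z L x -> spanned (gens st) x].
Proof.
elim/last_ind: L => [|L u IH] /=.
  by split=> // x _; apply: span_unit_rows.
rewrite foldl_rcons; set st := foldl _ _ _ in IH *; case: IH => IHo IHs IHg.
split.
- move=> j; rewrite has_rcons orbC -IHo.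
  by case: (st) => [[[o a] p] ys].
- have [p [ys [E [p' [ys' [E' Eg]]]]]] := gens_edge_step z st u => g gin0.
  have {gin0} gin : List.In g (p' :: flatten_rows ys') by rewrite -Eg.
  have S1 := eliminate_closed (@dot_lin _ _ (edge_eq b N u.1.1 u.1.2 u.2))
    (@solution0 z L) (@solution_lin z L) IHs.
  rewrite E /= in S1.
  have S2 := @eliminate_closed _ _ _ (@dot_lin _ _ (zero_eq b essp N z u.1.1 u.1.2))
    (fun g => solution z L g /\ dot (edge_eq b N u.1.1 u.1.2 u.2) g = 0) p (flatten_rows ys).
  rewrite E' /= in S2; apply/solution_rcons.
  have lin a v w : solution z L v /\ dot (edge_eq b N u.1.1 u.1.2 u.2) v = 0 ->
      solution z L w /\ dot (edge_eq b N u.1.1 u.1.2 u.2) w = 0 ->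
      solution z L (a *: v + w) /\ dot (edge_eq b N u.1.1 u.1.2 u.2) (a *: v + w) = 0.
    move=> [v1 v2] [w1 w2]; split; first exact: solution_lin.
    by rewrite dot_lin v2 w2 mulr0 addr0.
  by have [[]] := S2 (conj (@solution0 z L) (dot0 _)) lin S1 g gin.
- have [p [ys [E [p' [ys' [E' Eg]]]]]] := gens_edge_step z st u => x.
  case/solution_rcons => xL x1 x2.
  have := eliminate_span (@dot_lin _ _ (edge_eq b N u.1.1 u.1.2 u.2)) x1 (IHg x xL).
  rewrite E /= => /(eliminate_span (@dot_lin _ _ (zero_eq b essp N z u.1.1 u.1.2)) x2).
  by rewrite E' -Eg.
Qed.

(** A coordinate that vanishes on all generators vanishes on their span, so inspecting the
    generators is enough. The first alternative covers pairs with nothing to solve: event z occurs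
    at j, or j is z. *)
Lemma round_okP nS L z : reflect
  (forall j : 'I_N, (j < nS)%N ->
     (exists2 u, u \in L & zero_set essp z u.1.1 u.1.2 j) \/
     (exists2 x : M, solution z L x & x.1 ord0 j != 0))
  (round_ok b essp N nS L z).
Proof.
rewrite /round_ok /all_separated; have [o s g] := gens_correct z L.
set st := foldl _ _ _ in o s g *.
apply: (iffP forallP) => H j.
  move=> jS; have := implyP (H j) jS; rewrite o => /orP[/hasP[u]|separated]; first by left; exists u.
  have [x xg xj] : exists2 x, List.In x (gens st) & x.1 ord0 j != 0.
    case/orP: separated => [|pj]; last by exists st.1.2 => //; left.
    rewrite /gens; elim: (flatten_rows _) => //= y ys IH /orP[yj|/IH[x [<-|xg] xj]].
    - by exists y => //; right; left.
    - by exists st.1.2 => //; left.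
    - by exists x => //; right; right.
  by right; exists x => //; apply: s.
apply/implyP => /(H j)[[u uL uz]|[x xL xj]].
  by rewrite o; apply/orP; left; apply/hasP; exists u.
apply/orP; right; apply/negPn/negP; rewrite negb_or negbK => /andP[/hasPn no /eqP p0].
have zero y : List.In y (gens st) -> y.1 ord0 j = 0.
  case=> [<-//|]; move: no; rewrite /separates; elim: (flatten_rows _) => //= w ws IH no.
  case=> [<-|yin].
    by apply/eqP; rewrite -[_ == _]negbK no // mem_head.
  by apply: IH => // v vw; apply: no; rewrite inE vw orbT.
case/eqP: xj.
apply: (@spanned_ind _ _ (fun y : M => y.1 ord0 j = 0) _ _ _ _ zero (g x xL)).
  by rewrite mxE.
by move=> a u v u0 v0; rewrite /= !mxE u0 v0 mulr0 addr0.
Qed.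

Lemma sum_indicator (f : 'I_N -> R) (k : 'I_N) :
  \sum_(j < N) (j == k :> nat)%:R * f j = f k.
Proof.
rewrite (bigD1 k) //= eqxx mul1r big1 ?addr0 // => j jk.
by rewrite (_ : (j == k :> nat) = false) ?mul0r //; apply: negbTE.
Qed.

Lemma dot_edge_eq (s e t : 'I_N) (x : M) :
  dot (edge_eq b N s e t) x = x.1 ord0 s + x.2 ord0 e - x.1 ord0 t.
Proof.
rewrite -(sum_indicator (x.1 ord0)) -(sum_indicator (x.2 ord0)).
rewrite -(sum_indicator (x.1 ord0) t) -big_split -sumrB; apply: eq_bigr => j _.
by rewrite /cdot /cellM /= !mxE; ring.
Qed.

Lemma dot_zero_eq z s e (x : M) :
  dot (zero_eq b essp N z s e) x =
  \sum_(j < N) (zero_set essp z s e j)%:R * x.1 ord0 j.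
Proof.
by apply: eq_bigr => j _; rewrite /cdot /cellM /= !mxE mul0r addr0.
Qed.

End Rounds.

(** * Regions as solutions of linear equations *)

Section GroupRegions.
Variables (b : nat) (A : TS).
Local Open Scope ring_scope.
Notation R := 'I_b.+2.

Definition group_region (X : st A -> R) (Y : ev A -> R) : Prop :=
  forall s e s', delta s e = Some s' -> X s + Y e = X s'.

(** The natural subtraction in the type is exact since m <= s, so it agrees with subtraction modulo
    q. *)
Lemma tauZPT_step (s : R) (x : pt_event b.+1) (s' : R) :
  ndelta (n := tauZPT b.+1) s x = Some s' ->
  s + (match x with inl p => (val p).2 - (val p).1 | inr k => k end) = s'.
Proof.
case: x => [p|k] /=; last by case=> <-; apply: val_inj.
case: (val p) => m n /=; case: leqP => // ms; case: insubP => //= u _ Eu [<-].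
apply: (@addIr _ m); rewrite -addrA subrK.
rewrite -[s]natr_Zp -[n]natr_Zp -[m]natr_Zp -[u]natr_Zp -!natrD Eu.
by rewrite -addnA [(n + m)%N]addnC addnA subnK.
Qed.

Lemma tauRZPT_step (s : R) (x : pt_event b.+1) (s' : R) :
  ndelta (n := tauRZPT b.+1) s x = Some s' ->
  s + (match x with inl p => (val p).2 - (val p).1 | inr k => k end) = s'.
Proof.
case: x => [p|k] /=; last by case=> <-; apply: val_inj.
by case: (val p) => m n /=; case: eqP => // -> [<-]; rewrite addrC subrK.
Qed.

(** Forwards, events become their differences n - m. Backwards, integer events suffice: they are
    total and belong to all three types. *)
Lemma SSP_group (tau : net_type) :
  [\/ tau = tauZPT b.+1, tau = tauZPPT b.+1 | tau = tauRZPT b.+1] ->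
  (SSP tau A <-> forall s s' : st A, s <> s' ->
     exists X Y, group_region X Y /\ X s <> X s').
Proof.
pose diff (x : pt_event b.+1) : R :=
  match x with inl p => (val p).2 - (val p).1 | inr k => k end.
case=> ->; split=> H s s' /H.
- case=> -[X Y XY] /= Xs; exists X, (diff \o Y); split=> // u e u' /XY.
  exact: tauZPT_step.
- case=> X [Y [XY Xs]].
  have P u e u' : delta u e = Some u' ->
      ndelta (n := tauZPT b.+1) (X u) (inr (Y e)) = Some (X u').
    by move=> /XY <-; congr Some; apply: val_inj.
  by exists (@Region A (tauZPT b.+1) X _ P).
- case=> -[X Y XY] /= Xs; exists X, (fun e => diff (val (Y e))); split=> // u e u' /XY.
  exact: tauZPT_step.
- case=> X [Y [XY Xs]].
  pose k e : nev (tauZPPT b.+1) := exist _ (inr (Y e) : pt_event b.+1) isT.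
  have P u e u' : delta u e = Some u' ->
      ndelta (n := tauZPPT b.+1) (X u) (k e) = Some (X u').
    by move=> /XY <-; congr Some; apply: val_inj.
  by exists (@Region A (tauZPPT b.+1) X _ P).
- case=> -[X Y XY] /= Xs; exists X, (diff \o Y); split=> // u e u' /XY.
  exact: tauRZPT_step.
- case=> X [Y [XY Xs]].
  have P u e u' : delta u e = Some u' ->
      ndelta (n := tauRZPT b.+1) (X u) (inr (Y e)) = Some (X u').
    by move=> /XY <-; congr Some; apply: val_inj.
  by exists (@Region A (tauRZPT b.+1) X _ P).
Qed.

(* Translating [m] to 0 makes the sources of [e] zeros of a region; conversely
   they are translated to 1, as the pair (0, 0) is not an event. *)
Lemma ESSP_group : ESSP (tauRZPT b.+1) A <->
  forall (e : ev A) s, delta s e = None ->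
    exists X Y, [/\ group_region X Y,
      forall u u', delta u e = Some u' -> X u = 0 & X s <> 0].
Proof.
split=> H e s /H.
  case=> -[X Y XY] /=; case Ye: (Y e) => [p|//] /=; case Ep: (val p) => [m n].
  case: eqP => // Xs _.
  pose diff (x : pt_event b.+1) : R :=
    match x with inl p => (val p).2 - (val p).1 | inr k => k end.
  exists (fun u => X u - m), (diff \o Y); split.
  - by move=> u f u' /XY/tauRZPT_step <-; rewrite addrAC.
  - move=> u u' /XY /=; rewrite Ye /= Ep; case: eqP => // -> _; exact: subrr.
  - by move/eqP; rewrite subr_eq0 => /eqP.
case=> X [Y [XY Xe Xs]].
have p1 : ((1 : R), 1 + Y e) != (ord0, ord0) by [].
pose Z f : pt_event b.+1 :=
  if f == e then inl (exist (fun p => p != (ord0, ord0)) _ p1) else inr (Y f).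
have P u f u' : delta u f = Some u' ->
    ndelta (n := tauRZPT b.+1) (1 + X u) (Z f) = Some (1 + X u').
  move=> uu'; rewrite /Z; case: eqP => fe /=.
    rewrite fe in uu'; rewrite (Xe _ _ uu') addr0 eqxx; congr Some.
    by rewrite -(XY _ _ _ uu') (Xe _ _ uu') add0r.
  by congr Some; rewrite -(XY _ _ _ uu') addrA; apply: val_inj.
exists (@Region A (tauRZPT b.+1) (fun u => 1 + X u) Z P) => /=.
rewrite /Z eqxx /=; case: eqP => // E; case: Xs.
by apply: (@addrI _ 1); rewrite E addr0.
Qed.

End GroupRegions.

(** * Length of the encoding *)

Section Decision.
Variables (b : nat) (A : TS).
Notation R := 'I_b.+2.

Definition edge_ranks : seq (nat * nat * nat) :=
  [seq (enum_rank t.1.1 : nat, enum_rank t.1.2 : nat, enum_rank t.2 : nat) | t <- edges A].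

Lemma encode_ts_code :
  encode A = ts_code #|st A| #|ev A| (enum_rank (init A)) edge_ranks.
Proof.
rewrite /encode /ts_code /=; do 3!congr (_ ++ _).
by rewrite /edge_ranks; elim: (edges A) => //= t L ->; rewrite /edge_code /= cats0 -!catA.
Qed.

Notation N := (size (encode A)).

Lemma size_unary k : size (unary k) = k.+1.
Proof. by rewrite size_rcons size_nseq. Qed.

Lemma card_st_encode : #|st A| <= N.
Proof. by rewrite encode_ts_code /ts_code size_cat size_unary addSnnS leq_addr. Qed.

Lemma card_ev_encode : #|ev A| <= N.
Proof.
rewrite encode_ts_code /ts_code !size_cat !size_unary addnCA.
by rewrite addSnnS leq_addr.
Qed.

(** Each of the 3 + 3 |delta| unary blocks has length at most n + 1, so the unary code is only
    quadratically long. *)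
Lemma size_encode : N <= (ts_size A).+1 * (ts_size A).+1 * 3.
Proof.
set n := ts_size A.
have nS : #|st A| <= n by rewrite /n /ts_size -addnA leq_addr.
have nE : #|ev A| <= n by rewrite /n /ts_size addnAC leq_addl.
have rS (s : st A) : (enum_rank s).+1 <= n by apply: leq_trans nS; apply: ltn_ord.
have rE (e : ev A) : (enum_rank e).+1 <= n by apply: leq_trans nE; apply: ltn_ord.
have sL : size (edges A) <= n by apply: leq_addl.
have : size (flatten [seq edge_code u | u <- edge_ranks]) <= size (edges A) * (n + (n + n)).
  rewrite /edge_ranks; elim: (edges A) => //= t L IH.
  rewrite /edge_code /= cats0 !size_cat !size_unary mulSn leq_add //.
  by rewrite leq_add ?leq_add.
rewrite encode_ts_code /ts_code !size_cat !size_unary => H.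
have H2 : size (edges A) * (n + (n + n)) <= n * (n + (n + n)) by rewrite leq_mul2r sL orbT.
have H3 := rS (init A).
have H4 := leq_trans H H2.
apply: (@leq_trans (n.+1 + (n.+1 + (n + n * (n + (n + n)))))).
  by rewrite !leq_add.
by clear; nia.
Qed.

End Decision.

(** * The verdict of the program *)

Section Answers.
Variables (b : nat) (A : TS).
Local Open Scope ring_scope.
Notation R := 'I_b.+2.
Notation N := (size (encode A)).
Notation M := ('rV[R]_N * 'rV[R]_N)%type.
Notation L := (edge_ranks A).

(** The first two blocks alone make the code longer than |S| and |E|, so both kinds of variables fit
    into [N] cells. *)
Definition st_index (s : st A) : 'I_N := widen_ord (card_st_encode A) (enum_rank s).
Definition ev_index (e : ev A) : 'I_N := widen_ord (card_ev_encode A) (enum_rank e).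

(** The default 0 fills the cells that stand for no state or no event; in particular x_z = 0 holds
    if z is not a state. *)
Definition vector_of (X : st A -> R) (Y : ev A -> R) : M :=
  (\row_j nth 0 (codom X) j, \row_j nth 0 (codom Y) j).

Lemma vector_of_st X Y s : (vector_of X Y).1 ord0 (st_index s) = X s.
Proof. by rewrite mxE nth_image enum_rankK. Qed.

Lemma vector_of_ev X Y e : (vector_of X Y).2 ord0 (ev_index e) = Y e.
Proof. by rewrite mxE nth_image enum_rankK. Qed.

Lemma edge_ranksP u : reflect
  (exists (s : st A) e s', delta s e = Some s' /\
     u = (enum_rank s : nat, enum_rank e : nat, enum_rank s' : nat))
  (u \in L).
Proof.
apply: (iffP mapP) => [[[[s e] s']]|[s [e [s' [d ->]]]]].
  by rewrite mem_enum => /eqP d ->; exists s, e, s'.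
by exists (s, e, s') => //; rewrite mem_enum; apply/eqP.
Qed.

Lemma solutionP essp z (x : M) : solution essp z L x <->
  group_region (fun s => x.1 ord0 (st_index s)) (fun e => x.2 ord0 (ev_index e)) /\
  forall (s : st A) e s', delta s e = Some s' ->
    dot (zero_eq b essp N z (enum_rank s) (enum_rank e)) x = 0.
Proof.
split=> [H|[H1 H2] u /edge_ranksP[s [e [s' [d ->]]]]].
  have H' (s : st A) e s' : delta s e = Some s' -> _ := fun d =>
    H (enum_rank s : nat, enum_rank e : nat, enum_rank s' : nat) (introT (edge_ranksP _)
       (ex_intro _ s (ex_intro _ e (ex_intro _ s' (conj d erefl))))).
  split=> s e s' /H'[H1 H2] //.
  apply/eqP; rewrite -subr_eq0; apply/eqP; rewrite -[RHS]H1.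
  by rewrite -(dot_edge_eq (st_index s) (ev_index e) (st_index s')).
split; last exact: H2 d.
rewrite -[LHS]/(dot (edge_eq b N (st_index s) (ev_index e) (st_index s')) x).
by rewrite dot_edge_eq (H1 _ _ _ d) subrr.
Qed.

Lemma dot_zero_essp z (s : 'I_N) e (x : M) :
  dot (zero_eq b true N z s e) x = if e == z then x.1 ord0 s else 0.
Proof.
rewrite dot_zero_eq /zero_set -(sum_indicator (x.1 ord0)).
case: eqP => _; first by apply: eq_bigr => j _; rewrite andbT.
by rewrite big1 // => j _; rewrite andbF mul0r.
Qed.

Lemma dot_zero_ssp (z : 'I_N) s e (x : M) :
  dot (zero_eq b false N z s e) x = x.1 ord0 z.
Proof. by rewrite dot_zero_eq (sum_indicator (x.1 ord0)). Qed.

(** Serves the rounds whose index names no event (ESSP) or no state (SSP), and the SSP of a system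
    without edges. *)
Lemma group_region_const : group_region (fun _ : st A => 1 : R) (fun _ => 0).
Proof. by move=> s e s' _; rewrite addr0. Qed.

Lemma group_region_vector (X : st A -> R) (Y : ev A -> R) :
  group_region X Y ->
  group_region (fun s => (vector_of X Y).1 ord0 (st_index s))
               (fun e => (vector_of X Y).2 ord0 (ev_index e)).
Proof. by move=> H s e s' /H E; rewrite !vector_of_st vector_of_ev. Qed.

Lemma st_indexE (j : 'I_N) : (j < #|st A|)%N -> exists s, j = st_index s.
Proof.
move=> jS; exists (enum_val (Ordinal jS)); apply: val_inj.
by rewrite /= enum_valK.
Qed.

Lemma one_neq0 : (1 : R) <> 0.
Proof. by []. Qed.

Lemma essp_answer :
  [forall z : 'I_N, round_ok b true N #|st A| L z] <-> ESSP (tauRZPT b.+1) A.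
Proof.
rewrite ESSP_group; split=> [/forallP H e s d|H].
  have sS : (st_index s < #|st A|)%N by apply: ltn_ord (enum_rank s).
  have /round_okP He := H (ev_index e).
  (* A zero imposed at [s] would come from an edge with event [e] leaving [s], against [d]. *)
  have [[u /edge_ranksP[s1 [e1 [s2 [d1 ->]]]]] /andP[/eqP Es /eqP Ee]|[x /solutionP[xR xz] xs]]
    := He (st_index s) sS.
    have s1E : s = s1 by apply/enum_rank_inj/val_inj; exact: Es.
    have e1E : e1 = e by apply/enum_rank_inj/val_inj; exact: Ee.
    by move: d1; rewrite -s1E e1E d.
  exists (fun s => x.1 ord0 (st_index s)), (fun e => x.2 ord0 (ev_index e)).
  split=> // [u u' d1|]; last exact/eqP.
  have := xz _ _ _ d1; rewrite -[X in dot X _]/(zero_eq b true N _ (st_index u) (ev_index e)).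
  by rewrite dot_zero_essp eqxx.
apply/forallP => z; apply/round_okP => j /st_indexE[s ->].
have sol (X : st A -> R) (Y : ev A -> R) : group_region X Y ->
    (forall (u : st A) e u', delta u e = Some u' -> enum_rank e = z :> nat -> X u = 0) -> X s <> 0 ->
    exists2 x : M, solution true z L x & x.1 ord0 (st_index s) != 0.
  move=> XY Xe Xs; exists (vector_of X Y); last by rewrite vector_of_st; apply/eqP.
  apply/solutionP; split; first exact: group_region_vector.
  move=> u e u' d; rewrite -[X in dot X _]/(zero_eq b true N _ (st_index u) (ev_index e)).
  rewrite dot_zero_essp; case: eqP => // ez.
  by rewrite vector_of_st; apply: Xe d ez.
have [zE|zE] := ltnP z #|ev A|; last first.
  right; apply: sol group_region_const _ one_neq0 => u e _ _ ez.
  by move: zE; rewrite -ez leqNgt ltn_ord.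
pose e := enum_val (Ordinal zE); have ez : enum_rank e = z :> nat by rewrite enum_valK.
case d: (delta s e) => [s'|].
  left; exists (enum_rank s : nat, enum_rank e : nat, enum_rank s' : nat).
    by apply/edge_ranksP; exists s, e, s'.
  by rewrite /zero_set /= eqxx ez eqxx.
have [X [Y [XY Xe Xs]]] := H e s d; right; apply: sol XY _ Xs => u e1 u' d1 e1z.
by apply: (Xe u u'); rewrite (_ : e = e1) //; apply/enum_rank_inj/val_inj; rewrite /= ez.
Qed.

Lemma ssp_answer (tau : net_type) :
  [\/ tau = tauZPT b.+1, tau = tauZPPT b.+1 | tau = tauRZPT b.+1] ->
  [forall z : 'I_N, round_ok b false N #|st A| L z] <-> SSP tau A.
Proof.
move=> tauE; rewrite (SSP_group A tauE); split=> [/forallP H s s' ss'|H].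
  (* Without edges no round imposes x_s = 0, so its solutions need not separate [s] from [s']; but
     then every map on states belongs to a region. *)
  have [L0|[u uL]] : L = [::] \/ exists u, u \in L.
    by case: L => [|u l]; [left|right; exists u; rewrite mem_head].
    exists (fun u => (u == s)%:R), (fun=> 0); split.
      move=> u e u' d.
      have : (enum_rank u : nat, enum_rank e : nat, enum_rank u' : nat) \in L.
        by apply/edge_ranksP; exists u, e, u'.
      by rewrite L0.
    by rewrite eqxx eq_sym; case: eqP.
  have sS : (st_index s' < #|st A|)%N by apply: ltn_ord (enum_rank s').
  have /round_okP Hs := H (st_index s).
  have [[v _ /eqP Es]|[x /solutionP[xR xz] xs]]
    := Hs (st_index s') sS.
    by case: ss'; apply/esym/enum_rank_inj/val_inj.
  exists (fun s => x.1 ord0 (st_index s)), (fun e => x.2 ord0 (ev_index e)).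
  (* Any edge has made the round impose x_s = 0. *)
  split=> //; have /edge_ranksP[s1 [e1 [s2 [d _]]]] := uL.
  by have := xz _ _ _ d; rewrite dot_zero_ssp => -> /esym/eqP; rewrite (negbTE xs).
apply/forallP => z; apply/round_okP => j /st_indexE[s ->].
have sol (X : st A -> R) (Y : ev A -> R) : group_region X Y ->
    (L != [::] -> nth 0 (codom X) z = 0) -> X s <> 0 ->
    exists2 x : M, solution false z L x & x.1 ord0 (st_index s) != 0.
  move=> XY Xz Xs; exists (vector_of X Y); last by rewrite vector_of_st; apply/eqP.
  apply/solutionP; split; first exact: group_region_vector.
  move=> u e u' d; rewrite dot_zero_ssp mxE; apply: Xz.
  have : (enum_rank u : nat, enum_rank e : nat, enum_rank u' : nat) \in L.
    by apply/edge_ranksP; exists u, e, u'.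
  by case: L.
have [L0|Ln] := eqVneq L [::].
  by right; apply: sol group_region_const _ one_neq0; rewrite L0.
have [zS|zS] := ltnP z #|st A|; last first.
  right; apply: sol group_region_const _ one_neq0 => _.
  by rewrite nth_default // size_image.
have [s1 Ez] := st_indexE zS.
have [->|ss1] := eqVneq s s1.
  left; case: L Ln => // u l _; exists u; first exact: mem_head.
  by rewrite /zero_set Ez.
have [X [Y [XY Xs]]] := H s s1 (elimN eqP ss1).
(* Translation makes the region vanish at the state of the round. *)
right; apply: (sol (fun u => X u - X s1) Y).
- by move=> u e u' /XY <-; rewrite addrAC.
- by move=> _; rewrite Ez nth_image enum_rankK subrr.
- by move/eqP; rewrite subr_eq0 => /eqP.
Qed.

End Answers.

(** * Polynomial time *)

Lemma leq_horner (p : {poly nat}) m n : m <= n -> p.[m]%R <= p.[n]%R.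
Proof.
move=> mn; elim/poly_ind: p => [|p c IH]; first by rewrite !horner0.
by rewrite !hornerE leq_add // leq_mul.
Qed.

Lemma answers_within_leq M m n w ans : m <= n ->
  answers_within M m w ans -> answers_within M n w ans.
Proof.
move=> mn; rewrite /answers_within -(subnK mn) iterD.
by elim: (n - m) => //= k IH /IH E; rewrite /step E.
Qed.

Lemma algorithm_decides b essp (Q : TS -> Prop) :
  (forall A, [forall z : 'I_(size (encode A)),
      round_ok b essp (size (encode A)) #|st A| (edge_ranks A) z] <-> Q A) ->
  polytime_decidable Q.
Proof.
move=> QE.
have [M [p Mp]] := cmd_decides (ctl_at b 0 true) (fun c => c.2) (wf_algorithm b essp).
(* The time bound [p] is in the length of the code, which is at most 3 (n + 1)^2. *)
exists M, (p \Po (('X + 1) * ('X + 1) * 3%:R%:P))%R => A.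
exists [forall z : 'I_(size (encode A)),
  round_ok b essp (size (encode A)) #|st A| (edge_ranks A) z]; split; first exact: QE.
have /esym E := encode_ts_code A.
rewrite -(@algorithm_correct b essp (size (encode A)) _ _ _ _ (congr1 size E)) E.
apply: answers_within_leq (Mp _); rewrite horner_comp leq_horner //.
  by apply: leq_trans (size_encode A) _; rewrite !hornerE -[(ts_size A).+1]addn1.
Qed.

Theorem theorem2 (b : nat) (hb : 1 <= b) :
  polytime_decidable (ESSP (tauRZPT b)) /\
  (forall tau : net_type,
     [\/ tau = tauZPT b, tau = tauZPPT b | tau = tauRZPT b] ->
     polytime_decidable (SSP tau)).
Proof.
(* With [b.+1] for [b], the states are ['I_b.+2], which carries a ring structure with 1 distinct
   from 0. *)
case: b hb => // b _; split.
  by apply: (@algorithm_decides b true) => A; apply: essp_answer.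
by move=> tau tauE; apply: (@algorithm_decides b false) => A; apply: ssp_answer.
Qed.
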